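(* Let $(X,\mu)$ be a standard probability space, $f:X\to X$ an ergodic invertible measure-preserving transformation, $(Y,\nu)$ a standard probability space, $M=L^\infty(Y,\nu)$ and $\tau(\phi)=\int\phi\,d\nu$. Let $c:\mathbb{Z}\times X\to M^\times\cap\mathrm{GL}^2(M,\tau)$ satisfy $c(n+m,x)=c(n,f^mx)c(m,x)$ for all $n,m\in\mathbb{Z}$ and a.e. $x$, be measurable for the Strong Operator Topology, and satisfy $\int_X\|\log(|c(1,x)|)\|_2\,d\mu(x)<\infty$. For a.e. $x$ let $\Lambda(x)>0$ be the limit operator, $\log\Lambda(x)=\lim_{n\to\infty}n^{-1}\log|c(n,x)|$ in $L^2(Y,\nu)$. Then for a.e. $x\in X$ there exists an essentially dense subspace $\mathcal{H}_x\subset L^2(M,\tau)=L^2(Y,\nu)$ such that for every $\xi\in\mathcal{H}_x$, $$\lim_{n\to\infty}\|c(n,x)\xi\|_2^{1/n}=\lim_{n\to\infty}\|\Lambda(x)^n\xi\|_2^{1/n}.$$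
   Context: $M=L^\infty(Y,\nu)$ acts on $L^2(Y,\nu)$ by multiplication operators, and (possibly unbounded) measurable functions are identified with the corresponding multiplication operators. $M^\times$ is the set of $\phi\in L^\infty(Y,\nu)$ with $1/\phi\in L^\infty(Y,\nu)$. $\mathrm{GL}^2(M,\tau)$ is the set of (classes of) a.e. nonzero measurable functions $\phi:Y\to\mathbb{C}$ with $\log|\phi|\in L^2(Y,\nu)$. $\|\cdot\|_2$ is the $L^2(Y,\nu)$-norm, with $\|a\xi\|_2=+\infty$ if $\xi$ is not in the domain of the multiplication operator $a$. A subspace $V\subset L^2(M,\tau)$ is essentially dense if for every $\varepsilon>0$ there is a projection $p\in M$ (here a characteristic function) with $\tau(I-p)<\varepsilon$ and $pL^2(M,\tau)\subset V$. The $L^2$-limit defining $\log\Lambda(x)$ exists for a.e. $x$ under the stated hypotheses. *)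

(* Defs.v *)
From HB Require Import structures.
From mathcomp Require Import all_boot all_order all_algebra.
From mathcomp Require Import all_classical all_reals all_analysis.
From mathcomp Require Import complex.

Set Implicit Arguments.
Unset Strict Implicit.
Unset Printing Implicit Defensive.

Import Order.TTheory GRing.Theory Num.Theory.
Import numFieldNormedType.Exports.

Local Open Scope classical_set_scope.
Local Open Scope complex_scope.
Local Open Scope ring_scope.

(* The sigma-algebra of T is, up to a bijection, the Borel sigma-algebra of a
   Polish space: a separable complete metric space. A pseudometric type is
   metric when it is Hausdorff. *)
Definition standard_borel (R : realType) d (T : measurableType d) : Prop :=
  exists (P : completePseudoMetricType R) (e : T -> P),
    [/\ bijective e, hausdorff_space P,
        (exists2 D : set P, countable D & dense D) &
        forall A : set T, measurable A <-> <<s [set U : set P | open U] >> (e @` A)].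

Section Dynamics.
Context d (X : measurableType d) (R : realType) (mu : probability X R).

Definition invertible_measure_preserving (f finv : X -> X) : Prop :=
  [/\ cancel f finv /\ cancel finv f,
      measurable_fun [set: X] f, measurable_fun [set: X] finv &
      forall A, measurable A -> mu (f @^-1` A) = mu A].

Definition ergodic (f : X -> X) : Prop :=
  forall A, measurable A -> f @^-1` A = A -> mu A = 0%E \/ mu A = 1%E.

Definition int_iter (f finv : X -> X) (m : int) : X -> X :=
  match m with
  | Posz n => iter n f
  | Negz n => iter n.+1 finv
  end.

End Dynamics.

(* Elements of L^oo, L^2 and GL^2 are represented by functions, and all the
   predicates below are invariant under equality nu-almost everywhere among
   measurable functions. The multiplication operator of phi sends xi to the
   pointwise product of phi and xi, and its absolute value is multiplication by
   the modulus of phi. *)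
Section FunctionSpaces.
Context d (Y : measurableType d) (R : realType) (nu : probability Y R).
Implicit Types (phi xi : Y -> R[i]) (A : set Y).

Definition modulus phi : Y -> R := fun y => ComplexField.Normc.normc (phi y).

Definition cmeasurable phi : Prop :=
  measurable_fun [set: Y] (fun y => complex.Re (phi y)) /\
  measurable_fun [set: Y] (fun y => complex.Im (phi y)).

(* This is +oo when phi is not square integrable. *)
Definition norm2 phi : \bar R := ('N[nu]_2%:E [EFin \o modulus phi])%E.

Definition L2 : set (Y -> R[i]) :=
  [set phi | cmeasurable phi /\ (norm2 phi < +oo)%E].

Definition Linfty : set (Y -> R[i]) :=
  [set phi | cmeasurable phi /\ ('N[nu]_+oo [EFin \o modulus phi] < +oo)%E].

(* The nonvanishing condition is needed because 0^-1 = 0. *)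
Definition Linfty_units : set (Y -> R[i]) :=
  [set phi | [/\ Linfty phi, {ae nu, forall y, phi y != 0} &
                 Linfty (fun y => (phi y)^-1)]].

Definition log_modulus phi : Y -> R := fun y => ln (modulus phi y).

Definition GL2 : set (Y -> R[i]) :=
  [set phi | [/\ cmeasurable phi, {ae nu, forall y, phi y != 0} &
                 log_modulus phi \in Lfun nu 2%:E]].

(* Basic neighbourhoods of a in the strong operator topology are given by
   finitely many conditions |(b - a) xi|_2 < e with xi in L^2. *)
Definition sot_open (U : set (Y -> R[i])) : Prop :=
  U `<=` Linfty /\
  forall a, U a -> exists (k : nat) (xi : 'I_k -> Y -> R[i]) (e : R),
    [/\ (0 < e)%R, forall i, L2 (xi i) &
        forall b, Linfty b ->
          (forall i, (norm2 (fun y => (b y - a y) * xi i y)%R < e%:E)%E) -> U b].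

Definition sot_measurable d' (X : measurableType d') (a : X -> Y -> R[i]) :
    Prop :=
  forall U, sot_open U -> measurable (a @^-1` U).

(* L = lim |a n|^(1/n), the limit of the logarithms being taken in L^2. *)
Definition log_limit (a : nat -> Y -> R[i]) (L : Y -> R) : Prop :=
  [/\ measurable_fun [set: Y] L, {ae nu, forall y, 0 < L y},
      (fun y => ln (L y)) \in Lfun nu 2%:E &
      (fun n : nat =>
         'N[nu]_2%:E [(fun y => (n%:R^-1 * log_modulus (a n) y - ln (L y))%R%:E)])%E
        @ \oo --> 0%E].

(* The last condition says that V is a union of classes modulo equality almost
   everywhere, that is, a subset of the quotient. *)
Definition L2_subspace (V : set (Y -> R[i])) : Prop :=
  [/\ V `<=` L2, V (fun=> 0),
      forall (z : R[i]) xi eta, V xi -> V eta ->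
        V (fun y => z * xi y + eta y) &
      forall xi eta, V xi -> L2 eta -> {ae nu, forall y, xi y = eta y} ->
        V eta].

Definition essentially_dense (V : set (Y -> R[i])) : Prop :=
  L2_subspace V /\
  forall e : R, (0 < e)%R -> exists A,
    [/\ measurable A, (\int[nu]_y (1 - \1_A y)%R%:E < e%:E)%E &
        forall xi, L2 xi -> V (fun y => \1_A y * xi y)].

End FunctionSpaces.

(* Main.v *)
Require Import Defs.
From mathcomp Require Import all_boot all_order all_algebra.
From mathcomp Require Import all_classical all_reals all_analysis.
From mathcomp Require Import complex ring lra measurable_realfun.

(** Write phi(x, y) = log |c(1, x)(y)|. The cocycle relation turns
    log |c(n, x)(y)| into the Birkhoff sum of phi(., y) along the orbit of x, up
    to the term log |c(0, x)(y)|, which does not depend on n. The ergodic theorem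
    applied for almost every y shows that n^-1 log |c(n, x)(y)| tends to
    G(y) = int phi(x', y) dmu(x') for almost every (x, y), so by Fubini, for
    almost every x, convergence holds almost everywhere in y. This limit must
    agree with the L^2 limit log Lambda(x).

    Fix such an x. By Egorov's theorem the convergence is uniform off sets of
    arbitrarily small measure; H_x consists of the square-integrable xi that
    vanish almost everywhere outside some measurable set on which it is uniform.
    For such xi and every q > 1, |c(n, x)| lies between q^-n Lambda(x)^n and
    q^n Lambda(x)^n on the support of xi once n is large, and both n-th roots of
    norms converge to the essential supremum of Lambda(x) on that support
    (cvg_Lnorm2_root, uniform_vectors_limit).

    Two ingredients are built here. The pointwise ergodic theorem
    (birkhoff_ergodic) comes from the running maxima
    M_(n+1) = max (0, g + M_n o f): the functions M_(n+1) - M_n o f have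
    nonnegative integral, are dominated by |g| and converge to g wherever M_n is
    unbounded. A jointly measurable version of |c(1, x)(y)| (sot_joint_modulus)
    is needed for Fubini: since Y is standard, L^1(Y) has a countable dense
    family of step functions; SOT-measurability makes the set of x at which
    |c(1, x)| is close to a given member of this family measurable, so a fast
    approximating sequence can be selected measurably in x. *)

Set Implicit Arguments.
Unset Strict Implicit.
Unset Printing Implicit Defensive.

Import Order.TTheory GRing.Theory Num.Theory.
Import numFieldNormedType.Exports.

Local Open Scope classical_set_scope.
Local Open Scope complex_scope.
Local Open Scope ring_scope.

(** * The pointwise ergodic theorem *)

Section MaximalErgodic.
Context (R : realType) (d : measure_display) (X : measurableType d)
  (mu : probability X R).
Variables (f finv : X -> X).
Hypothesis f_pmp : invertible_measure_preserving mu f finv.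

(** The sum of g over the first n points x, f x, ..., f^(n-1) x of an orbit. *)
Definition birkhoff_sum (g : X -> R) (n : nat) (x : X) : R :=
  \sum_(i < n) g (iter i f x).

(** The maximum of the Birkhoff sums of lengths 0 to n, through the recursion
    M_(n+1) = max (0, g + M_n o f). *)
Fixpoint birkhoff_max (g : X -> R) (n : nat) (x : X) : R :=
  if n is n'.+1 then Num.max 0 (g x + birkhoff_max g n' (f x)) else 0.

Lemma birkhoff_sumS g n x :
  birkhoff_sum g n.+1 x = g x + birkhoff_sum g n (f x).
Proof.
rewrite /birkhoff_sum big_ord_recl /=; congr (_ + _).
by apply: eq_bigr => i _; rewrite -iterSr.
Qed.

Lemma birkhoff_max_ge0 g n x : 0 <= birkhoff_max g n x.
Proof. by case: n => [|n] //=; rewrite le_max lexx. Qed.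

Lemma birkhoff_max_homo g n x : birkhoff_max g n x <= birkhoff_max g n.+1 x.
Proof.
elim: n x => [|n IH] x; first by rewrite /= le_max lexx.
rewrite [leLHS]/= [leRHS]/= ge_max le_max lexx /=.
by rewrite le_max; apply/orP; right; rewrite lerD2l; exact: IH.
Qed.

Lemma birkhoff_max_nd g x : nondecreasing_seq (birkhoff_max g ^~ x).
Proof. by apply/nondecreasing_seqP => n; exact: birkhoff_max_homo. Qed.

Lemma birkhoff_sum_le_max g n x : birkhoff_sum g n x <= birkhoff_max g n x.
Proof.
elim: n x => [|n IH] x; first by rewrite /birkhoff_sum big_ord0.
by rewrite birkhoff_sumS [leRHS]/= le_max lerD2l IH orbT.
Qed.

Lemma measurable_birkhoff_max (g : X -> R) n :
  measurable_fun setT g -> measurable_fun setT (birkhoff_max g n).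
Proof.
move=> mg; have [_ mf _ _] := f_pmp.
elim: n => [|n IH]; first exact: measurable_cst.
apply: measurable_maxr; first exact: measurable_cst.
apply: measurable_funD => //.
exact: measurableT_comp.
Qed.

Lemma ge0_integral_pmp (h : X -> \bar R) : measurable_fun setT h ->
  (forall x, 0 <= h x)%E -> (\int[mu]_x h (f x) = \int[mu]_x h x)%E.
Proof.
move=> mh h0; have [_ mf _ fmu] := f_pmp.
rewrite -[LHS](@ge0_integral_pushforward _ _ _ _ _ _ mf mu setT h)//.
by apply: eq_measure_integral => A mA _; exact: fmu.
Qed.

Lemma integrable_pmp (h : X -> R) : mu.-integrable setT (EFin \o h) ->
  mu.-integrable setT (EFin \o (h \o f)).
Proof.
move=> /integrableP[mh ih]; have [_ mf _ _] := f_pmp.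
apply/integrableP; split.
  by rewrite compA; exact: measurableT_comp.
rewrite (ge0_integral_pmp (h := fun x => `|(h x)%:E|%E))//.
exact: measurableT_comp.
Qed.

Lemma integral_pmp (h : X -> R) : mu.-integrable setT (EFin \o h) ->
  (\int[mu]_x (h (f x))%:E = \int[mu]_x (h x)%:E)%E.
Proof.
move=> ih; have /integrableP[mh _] := ih.
rewrite [LHS]integralE [RHS]integralE; congr (_ - _)%E.
  rewrite -[RHS](ge0_integral_pmp (h := ((EFin \o h)^\+)%E))//.
    by apply: eq_integral => x _; rewrite !unlock.
  exact: measurable_funepos.
rewrite -[RHS](ge0_integral_pmp (h := ((EFin \o h)^\-)%E))//.
  by apply: eq_integral => x _; rewrite !unlock.
exact: measurable_funeneg.
Qed.

Lemma integrable_birkhoff_max (g : X -> R) n :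
  mu.-integrable setT (EFin \o g) ->
  mu.-integrable setT (EFin \o birkhoff_max g n).
Proof.
move=> ig; elim: n => [|n IH]; first exact: integrable0.
have -> : EFin \o birkhoff_max g n.+1 =
    ((EFin \o (fun x => g x + birkhoff_max g n (f x))%R)^\+)%E.
  by apply/funext => x; rewrite funeposE /= EFin_max maxC.
apply: integrable_funepos => //.
rewrite (_ : _ \o _ = (EFin \o g) \+ (EFin \o (birkhoff_max g n \o f)))%E//.
by apply: integrableD => //; exact: integrable_pmp.
Qed.

(** The points at which the maxima, equivalently the Birkhoff sums, are not
    bounded above. *)
Definition birkhoff_unbounded (g : X -> R) : set X :=
  \bigcap_(k : nat) \bigcup_(n : nat) [set x | k%:R <= birkhoff_max g n x].

Lemma measurable_birkhoff_unbounded g :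
  measurable_fun setT g -> measurable (birkhoff_unbounded g).
Proof.
move=> mg; apply: bigcapT_measurable => k; apply: bigcupT_measurable => n.
rewrite -[X in measurable X]setTI.
rewrite (_ : [set x | _] = birkhoff_max g n @^-1` `[k%:R, +oo[%classic).
  exact: measurable_birkhoff_max.
by apply/seteqP; split => x; rewrite /= in_itv /= andbT.
Qed.

(** Strict invariance: M_(n+1) at x and M_n at f x differ by at most |g x|. *)
Lemma birkhoff_unbounded_invariant g :
  f @^-1` birkhoff_unbounded g = birkhoff_unbounded g.
Proof.
apply/seteqP; split => x Ex k _ /=.
  pose j := (k + Num.truncn `|g x|).+1.
  have [n _ /= hn] := Ex j I.
  exists n.+1 => //=; rewrite le_max; apply/orP; right.
  have : `|g x| < (Num.truncn `|g x|).+1%:R by apply: truncnS_gt.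
  have : - g x <= `|g x| by rewrite -normrN ler_norm.
  move: hn; rewrite /j -addnS natrD; lra.
pose j := (k + Num.truncn `|g x|).+1.
have [n _ /= hn] := Ex j I.
exists n => //=.
have : `|g x| < (Num.truncn `|g x|).+1%:R by apply: truncnS_gt.
have : g x <= `|g x| by rewrite ler_norm.
have j0 : (0 : R) < j%:R by rewrite ltr0n.
case: n hn => [|n] hn; first by move: hn; rewrite /= leNgt j0.
have := birkhoff_max_homo g n (f x).
move: hn; rewrite [birkhoff_max g n.+1 x]/= le_max leNgt j0 /=.
rewrite /j -addnS natrD; lra.
Qed.

Hypothesis f_ergodic : ergodic mu f.

(** A maximal ergodic argument. Were the set of full measure, the functions
    D_n = M_(n+1) - M_n o f = max (- M_n o f, g), which have nonnegative integral
    by invariance of mu, would converge almost everywhere to g, dominated by |g|. *)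
Lemma birkhoff_unbounded_null g : mu.-integrable setT (EFin \o g) ->
  (\int[mu]_x (g x)%:E < 0)%E -> mu (birkhoff_unbounded g) = 0%E.
Proof.
move=> ig g0; have mg : measurable_fun setT g.
  by apply/measurable_EFinP; case/integrableP: ig.
have mE := measurable_birkhoff_unbounded mg.
have [//|E1] := f_ergodic mE (birkhoff_unbounded_invariant g).
exfalso; move: g0; apply/negP; rewrite -leNgt.
have aeE : {ae mu, forall x, birkhoff_unbounded g x}.
  exists (~` birkhoff_unbounded g); split => //; first exact: measurableC.
  by have := probability_setC mu mE; rewrite E1 subee.
pose D n x := birkhoff_max g n.+1 x - birkhoff_max g n (f x).
have iM n := integrable_birkhoff_max n ig.
have iMf n := integrable_pmp (iM n).
have DE n x : D n x = Num.max (- birkhoff_max g n (f x)) (g x).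
  by rewrite /D /= addr_maxl add0r addrK.
have intD n : (0 <= \int[mu]_x (D n x)%:E)%E.
  rewrite /D; under eq_integral do rewrite EFinB.
  rewrite integralB_EFin//; last exact: iMf.
  rewrite integral_pmp// sube_ge0; last first.
    by apply/orP; left; exact: (integrable_fin_num measurableT (iM n)).
  apply: le_integral => //; [exact: iM|exact: iM|move=> x _].
  by rewrite lee_fin; exact: birkhoff_max_homo.
have [|||||_ _ cD] := @dominated_convergence _ _ _ mu setT measurableT
    (fun n => EFin \o D n) (EFin \o g) (abse \o (EFin \o g)).
- move=> n; apply/measurable_EFinP; apply: measurable_funB.
    exact: measurable_birkhoff_max.
  apply: measurableT_comp => //; first exact: measurable_birkhoff_max.
  by case: f_pmp.
- exact/measurable_EFinP.
- apply: filterS aeE => x Ex _.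
  have := Ex; rewrite -birkhoff_unbounded_invariant => Efx.
  have [n _ /= hn] := Efx (Num.truncn `|g x|).+1 I.
  apply: cvg_near_cst; exists n => // m /= nm.
  rewrite DE; congr EFin; apply/max_idPr.
  have := birkhoff_max_nd g (f x) nm.
  have := truncnS_gt `|g x|; have : - g x <= `|g x| by rewrite -normrN ler_norm.
  move: hn; lra.
- exact: integrable_abse.
- apply: nearW => x n _ /=; rewrite lee_fin DE.
  have := birkhoff_max_ge0 g n (f x).
  case: (leP (g x) (- birkhoff_max g n (f x))) => [h1 h2|//].
  by rewrite ler0_norm ?ler0_norm; lra.
rewrite /= in cD; rewrite -(cvg_lim _ cD)//; apply: lime_ge.
  by apply/cvg_ex; eexists; exact: cD.
by apply: nearW => n; exact: intD.
Qed.

Lemma birkhoff_sum_bounded g : mu.-integrable setT (EFin \o g) ->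
  (\int[mu]_x (g x)%:E < 0)%E ->
  {ae mu, forall x, exists C : R, forall n, birkhoff_sum g n x <= C}.
Proof.
move=> ig g0; have mg : measurable_fun setT g.
  by apply/measurable_EFinP; case/integrableP: ig.
exists (birkhoff_unbounded g); split.
- exact: measurable_birkhoff_unbounded.
- exact: birkhoff_unbounded_null.
- move=> x /= nx k _; apply: contrapT => /= nk; apply: nx; exists k%:R => n.
  apply: le_trans (birkhoff_sum_le_max g n x) _.
  by rewrite leNgt; apply/negP => kn; apply: nk; exists n => //=; exact: ltW.
Qed.

(** Subtract from g a constant m' strictly between its mean and m: the Birkhoff
    sums of g - m' are bounded above. *)
Lemma birkhoff_upper g (m : R) : mu.-integrable setT (EFin \o g) ->
  (\int[mu]_x (g x)%:E < m%:E)%E ->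
  {ae mu, forall x, \forall n \near \oo, n%:R^-1 * birkhoff_sum g n x <= m}.
Proof.
move=> ig gm.
have [m' [gm' m'm]] : exists m', (\int[mu]_x (g x)%:E < m'%:E)%E /\ m' < m.
  have := integrable_fin_num measurableT ig.
  move: gm; rewrite /=; case: (\int[mu]_x _)%E => // r.
  rewrite lte_fin => rm _; exists ((r + m) / 2); rewrite lte_fin; lra.
have ig' : mu.-integrable setT (EFin \o (fun x => g x - m')).
  rewrite (_ : _ \o _ = (EFin \o g) \- (EFin \o cst m'))%E//.
  apply: integrableB => //; exact: finite_measure_integrable_cst.
have := birkhoff_sum_bounded ig'.
have -> : (\int[mu]_x (g x - m')%:E = \int[mu]_x (g x)%:E - m'%:E)%E.
  under eq_integral do rewrite EFinB.
  rewrite integralB_EFin//; last exact: finite_measure_integrable_cst.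
  by rewrite integral_cst//= probability_setT mule1.
rewrite sube_lt0 ?orbT// => /(_ gm'); apply: filterS => x [C hC].
near=> n; have n0 : (0 : R) < n%:R by rewrite ltr0n; near: n; exact: nbhs_infty_gt.
rewrite mulrC ler_pdivrMr//.
have := hC n; rewrite /birkhoff_sum big_split/= sumr_const card_ord -/(birkhoff_sum g n x).
rewrite mulNrn -mulr_natr => h.
have : C <= (m - m') * n%:R.
  rewrite mulrC -ler_pdivrMr ?subr_gt0//.
  near: n; exact: nbhs_infty_ger.
move: h; lra.
Unshelve. all: by end_near. Qed.

(** Birkhoff's theorem for ergodic transformations, from the upper bound applied
    to g and to - g. *)
Lemma birkhoff_ergodic g : mu.-integrable setT (EFin \o g) ->
  {ae mu, forall x, n%:R^-1 * birkhoff_sum g n x @[n --> \oo] -->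
    fine (\int[mu]_x (g x)%:E)}.
Proof.
move=> ig; set m := fine _.
have fm := integrable_fin_num measurableT ig.
have mE : (\int[mu]_x (g x)%:E = m%:E)%E by rewrite fineK.
have igN : mu.-integrable setT (EFin \o (fun x => - g x)).
  rewrite (_ : _ \o _ = \- (EFin \o g))%E//; exact: integrableN.
have mEN : (\int[mu]_x (- g x)%:E = (- m)%:E)%E.
  by under eq_integral do rewrite EFinN; rewrite integralN ?mE//; 
     exact: integrable_add_def.
have up : {ae mu, forall x, forall k : nat, \forall n \near \oo,
    n%:R^-1 * birkhoff_sum g n x <= m + k.+1%:R^-1}.
  apply/ae_foralln => k; apply: birkhoff_upper => //.
  by rewrite mE lte_fin ltrDl invr_gt0.
have lo : {ae mu, forall x, forall k : nat, \forall n \near \oo,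
    n%:R^-1 * birkhoff_sum (fun x => - g x) n x <= - m + k.+1%:R^-1}.
  apply/ae_foralln => k; apply: birkhoff_upper => //.
  by rewrite mEN lte_fin ltrDl invr_gt0.
apply: filterS2 up lo => x up lo.
apply/cvgrPdist_le => e e0.
have [k _ /(_ k (leqnn _)) /= ke] := near_infty_natSinv_lt (PosNum e0).
near=> n.
have h1 : n%:R^-1 * birkhoff_sum g n x <= m + k.+1%:R^-1 by near: n; exact: up.
have h2 : n%:R^-1 * birkhoff_sum (fun x => - g x) n x <= - m + k.+1%:R^-1.
  by near: n; exact: lo.
move: h2; rewrite /birkhoff_sum sumrN mulrN -/(birkhoff_sum g n x) => h2.
rewrite ler_distlC.
move: (n%:R^-1 * _) (k.+1%:R^-1) (m) h1 h2 ke => s q m0 h1 h2 ke.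
by apply/andP; split; move: h1 h2 (ltW ke) => /=; move: (e : R) => e'; lra.
Unshelve. all: by end_near. Qed.

End MaximalErgodic.

(** * Roots of L^2 norms and the essential supremum *)

Section NormRoots.
Context (R : realType) (d : measure_display) (Y : measurableType d)
  (nu : probability Y R).

(** Convergence of extended reals tested against real bounds on either side;
    the limit may be infinite. *)
Lemma cvge_squeeze_fin (a : nat -> \bar R) (l : \bar R) :
  (forall s : R, (s%:E < l)%E -> \forall n \near \oo, (s%:E <= a n)%E) ->
  (forall r : R, (l < r%:E)%E -> \forall n \near \oo, (a n <= r%:E)%E) ->
  a n @[n --> \oo] --> l.
Proof.
case: l => [l||] lo up.
- have lo1 (e : R) : 0 < e -> \forall n \near \oo, ((l - e)%:E <= a n)%E.
    by move=> e0; apply: lo; rewrite lte_fin ltrBlDr ltrDl.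
  have up1 (e : R) : 0 < e -> \forall n \near \oo, (a n <= (l + e)%:E)%E.
    by move=> e0; apply: up; rewrite lte_fin ltrDl.
  apply/fine_cvgP; split.
    near=> n; have h1 : ((l - 1)%:E <= a n)%E by near: n; exact: lo1.
    have h2 : (a n <= (l + 1)%:E)%E by near: n; exact: up1.
    by move: h1 h2; case: (a n).
  apply/cvgrPdist_le => e e0; near=> n.
  have h1 : ((l - e)%:E <= a n)%E by near: n; exact: lo1.
  have h2 : (a n <= (l + e)%:E)%E by near: n; exact: up1.
  move: h1 h2 => /=; case: (a n) => //= r; rewrite !lee_fin => h1 h2.
  by rewrite ler_distlC h1 h2.
- by apply/cvgeyPge => A; apply: lo; rewrite ltry.
- by apply/cvgeNyPle => A; apply: up; rewrite ltNyr.
Unshelve. all: by end_near. Qed.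

Lemma near_expr_le (x e : R) : 0 <= x -> x < 1 -> 0 < e ->
  \forall n \near \oo, x ^+ n <= e.
Proof.
move=> x0 x1 e0.
have /cvgrPdist_le /(_ e e0) : x ^+ n @[n --> \oo] --> (0 : R).
  by apply: cvg_expr; rewrite ger0_norm.
apply: filterS => n; rewrite sub0r normrN ger0_norm// exprn_ge0//.
Qed.

Lemma near_expr_ge (x e : R) : 1 < x -> \forall n \near \oo, e <= x ^+ n.
Proof.
move=> x1; have x0 : 0 < x by apply: lt_trans x1.
have e1 : 0 < `|e| + 1 by rewrite ltr_wpDl.
have [|||N _ hN] := @near_expr_le x^-1 (`|e| + 1)^-1.
- by rewrite invr_ge0 ltW.
- by rewrite invf_lt1.
- by rewrite invr_gt0.
exists N => // n /hN /=.
rewrite exprVn lef_pV2 ?posrE ?exprn_gt0// => h.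
by have := ler_norm e; move: h; lra.
Qed.

Lemma Lnorm2E (f : Y -> R) :
  ('N[nu]_2%:E [EFin \o f] = (\int[nu]_y (f y ^+ 2)%:E) `^ 2^-1)%E.
Proof.
rewrite unlock; congr (_ `^ _)%E; apply: eq_integral => y _ /=.
by rewrite powR_mulrn// real_normK// num_real.
Qed.

Lemma poweR_root (I : \bar R) (n : nat) :
  ((I `^ 2^-1) `^ n%:R^-1 = I `^ (2 * n)%:R^-1)%E.
Proof. by rewrite -poweRrM natrM invfM. Qed.

Lemma poweR_root_expr (s : R) (n : nat) : 0 <= s -> (0 < n)%N ->
  ((s ^+ n)%:E `^ n%:R^-1 = s%:E)%E.
Proof.
move=> s0 n0; rewrite poweR_EFin -powR_mulrn// -powRrM mulfV ?pnatr_eq0 -?lt0n//.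
by rewrite powRr1.
Qed.

Lemma root_ge (I : \bar R) (s : R) (n : nat) : 0 <= s -> (0 < n)%N ->
  ((s ^+ (2 * n))%:E <= I)%E -> (s%:E <= (I `^ 2^-1) `^ n%:R^-1)%E.
Proof.
move=> s0 n0 h; rewrite poweR_root -(@poweR_root_expr s (2 * n))//; last first.
  by rewrite muln_gt0.
apply: gt0_ler_poweR => //.
- by rewrite in_itv /= leey lee_fin exprn_ge0.
- by rewrite in_itv /= leey (le_trans _ h)// lee_fin exprn_ge0.
Qed.

Lemma root_le (I : \bar R) (s : R) (n : nat) : 0 <= s -> (0 < n)%N ->
  (0 <= I)%E ->
  (I <= (s ^+ (2 * n))%:E)%E -> ((I `^ 2^-1) `^ n%:R^-1 <= s%:E)%E.
Proof.
move=> s0 n0 I0 h; rewrite poweR_root -(@poweR_root_expr s (2 * n))//; last first.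
  by rewrite muln_gt0.
apply: gt0_ler_poweR => //.
- by rewrite in_itv /= leey I0.
- by rewrite in_itv /= leey lee_fin exprn_ge0.
Qed.

(** The essential supremum of K on the set where w does not vanish, for K >= 0.
    It is 0 when w vanishes almost everywhere. *)
Definition weighted_ess_sup (K w : Y -> R) : \bar R :=
  ereal_sup ([set 0%E] `|` [set t%:E | t in [set t : R |
    0 <= t /\ (0 < nu [set y | (t < K y)%R /\ w y != 0%R])%E]]).

(** If h_n = K^n up to factors q^n and q^-n, for every q > 1, on the support of
    w, then the n-th root of the norm of h_n w tends to the essential supremum of
    K there. Below: restrict to {K > t}, where h_n >= (t / q)^n. Above: K <= r'
    almost everywhere on the support. *)
Lemma cvg_Lnorm2_root (K w : Y -> R) (h : nat -> Y -> R) :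
  measurable_fun setT K -> measurable_fun setT w ->
  (forall n, measurable_fun setT (h n)) ->
  (\int[nu]_y (w y ^+ 2)%:E < +oo)%E ->
  (forall q : R, 1 < q -> \forall n \near \oo, {ae nu, forall y, w y != 0 ->
     [/\ 0 <= K y, q ^- n * K y ^+ n <= h n y & h n y <= q ^+ n * K y ^+ n]}) ->
  ('N[nu]_2%:E [EFin \o (fun y => h n y * w y)%R] `^ n%:R^-1)%E @[n --> \oo] -->
    weighted_ess_sup K w.
Proof.
move=> mK mw mh wfin hK.
have mw2 : measurable_fun setT (fun y => (w y ^+ 2)%:E).
  by apply/measurable_EFinP; exact: measurable_funX.
have mhw n : measurable_fun setT (fun y => ((h n y * w y) ^+ 2)%:E).
  by apply/measurable_EFinP; apply: measurable_funX; exact: measurable_funM.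
have mS t : measurable [set y | t < K y /\ w y != 0].
  rewrite [X in measurable X](_ : _ =
     (setT `&` K @^-1` `]t, +oo[%classic) `&` (setT `&` w @^-1` [set~ 0])).
    by apply: measurableI; [exact: mK|apply: mw => //; exact: measurableC].
  rewrite !setTI; apply/seteqP; split => y /=; rewrite in_itv /= andbT.
    by move=> [? /eqP ?].
  by move=> [? /eqP ?].
apply: cvge_squeeze_fin => [s sl|r lr].
- have [s0|s0] := leP s 0.
    by apply: nearW => n; apply: (@le_trans _ _ 0%E); rewrite ?lee_fin// poweR_ge0.
  have [_ [->|[t [t0 St] <-]]] := ereal_sup_gt sl.
    by rewrite lte_fin ltNge (ltW s0).
  rewrite lte_fin => st.
  have {}t0 : 0 < t by apply: lt_trans st.
  set S := [set y | t < K y /\ w y != 0] in St.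
  pose D := (\int[nu]_(y in S) (w y ^+ 2)%:E)%E.
  have D0 : (0 < D)%E.
    rewrite lt_neqAle integral_ge0 ?andbT; last first.
      by move=> y _; rewrite lee_fin sqr_ge0.
    apply/negP => /eqP /esym D0.
    have := (ae_eq_integral_abs nu (mS t)
      (measurable_funS measurableT (@subsetT _ _) mw2)).1.
    rewrite -/S; under eq_integral => y _ do
      rewrite gee0_abs ?lee_fin ?sqr_ge0//.
    rewrite -/D => /(_ D0) [N [mN N0 SN]].
    suff : (nu S <= nu N)%E by rewrite N0 leNgt St.
    apply: le_measure; rewrite ?inE//; first exact: mS.
    move=> y Sy; apply: SN => /=; case: Sy => Ky wy /(_ (conj Ky wy)) [] /eqP.
    by rewrite sqrf_eq0 (negbTE wy).
  have Dfin : (D < +oo)%E.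
    apply: le_lt_trans wfin; apply: ge0_subset_integral => //; first exact: mS.
    by move=> y _; rewrite lee_fin sqr_ge0.
  have Dr : D = (fine D)%:E by rewrite fineK// ge0_fin_numE// ltW.
  have fD0 : 0 < fine D by rewrite -lte_fin -Dr.
  (* This choice gives s * q = (s + t) / 2, strictly between s and t. *)
  pose q := (s + t) / (2 * s).
  have q1 : 1 < q by rewrite /q ltr_pdivlMr ?mulr_gt0// mul1r; lra.
  have q0 : 0 < q by apply: lt_trans q1.
  have sqt : s * q < t.
    have -> : s * q = (s + t) / 2 by rewrite /q; field; rewrite gt_eqF.
    lra.
  clearbody q; near=> n.
  have n0 : (0 < n)%N by near: n; exact: nbhs_infty_gt.
  rewrite Lnorm2E; apply: root_ge => //; first exact: ltW.
  have hn : {ae nu, forall y, w y != 0 ->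
    [/\ 0 <= K y, q ^- n * K y ^+ n <= h n y & h n y <= q ^+ n * K y ^+ n]}.
    by near: n; exact: hK.
  have small : ((s * q / t) ^+ 2) ^+ n <= fine D.
    near: n; apply: near_expr_le => //; first by rewrite sqr_ge0.
    rewrite expr_lt1 ?ltr_pdivrMr ?mul1r// divr_ge0// ?mulr_ge0 ?ltW//.
  apply: (@le_trans _ _ (((t / q) ^+ (2 * n))%:E * D)%E).
    rewrite Dr -EFinM lee_fin.
    rewrite mulrC -ler_pdivrMr ?exprn_gt0 ?divr_gt0//.
    rewrite -expr_div_n exprM; apply: le_trans small.
    by rewrite le_eqVlt; apply/orP; left; apply/eqP; congr ((_ ^+ _) ^+ _); field;
       rewrite !gt_eqF.
  have mSt : measurable S by exact: mS.
  rewrite /D -ge0_integralZl; [|by []|exact: measurable_funS mw2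
    |by move=> y _; rewrite lee_fin sqr_ge0
    |by rewrite lee_fin exprn_ge0// divr_ge0 ?ltW].
  apply: (@le_trans _ _ (\int[nu]_(y in S) ((h n y * w y) ^+ 2)%:E)%E); last first.
    apply: ge0_subset_integral => //.
    by move=> y _; rewrite lee_fin sqr_ge0.
  apply: ae_ge0_le_integral => //.
  + by move=> y _; rewrite -EFinM lee_fin mulr_ge0 ?sqr_ge0// exprn_ge0// divr_ge0 ?ltW.
  + by apply/measurable_funeM; exact: measurable_funS mw2.
  + by move=> y _; rewrite lee_fin sqr_ge0.
  + exact: measurable_funS (mhw n).
  apply: filterS hn => y /[swap] -[tK wy] /(_ wy) [K0 lb _].
  rewrite -EFinM lee_fin [leRHS]exprMn ler_wpM2r ?sqr_ge0// mulnC exprM.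
  have h0 : 0 <= h n y.
    by apply: le_trans lb; rewrite mulr_ge0 ?exprn_ge0// invr_ge0 exprn_ge0// ltW.
  have tq0 : 0 <= (t / q) ^+ n by rewrite exprn_ge0// divr_ge0// ltW.
  rewrite ler_sqr ?nnegrE//.
  apply: le_trans lb; rewrite expr_div_n mulrC ler_wpM2l//.
    by rewrite invr_ge0 exprn_ge0// ltW.
  by rewrite lerXn2r ?nnegrE// ltW.
- have l0 : (0 <= weighted_ess_sup K w)%E by apply: ereal_sup_ubound; left.
  have [r' lr' [r'r r'0]] : exists2 r' : R, (weighted_ess_sup K w < r'%:E)%E & r' < r /\ 0 < r'.
    move: l0 lr; case: (weighted_ess_sup K w) => // l; rewrite lee_fin lte_fin => l0 lr.
    by exists ((l + r) / 2); rewrite ?lte_fin; lra.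
  have r0 : 0 < r by apply: lt_trans r'r.
  have null : nu [set y | r' < K y /\ w y != 0] = 0%E.
    apply: contrapT => /eqP nn; move: lr'; apply/negP; rewrite -leNgt.
    apply: ereal_sup_ubound; right; exists r' => //; split; first exact: ltW.
    by rewrite lt0e nn measure_ge0.
  have Kr : {ae nu, forall y, w y != 0 -> K y <= r'}.
    exists [set y | r' < K y /\ w y != 0]; split => //.
    by move=> y /= /not_implyP[wy /negP]; rewrite -ltNge.
  set C := (\int[nu]_y (w y ^+ 2)%:E)%E in wfin.
  have C0 : (0 <= C)%E by apply: integral_ge0 => y _; rewrite lee_fin sqr_ge0.
  have Cr : C = (fine C)%:E by rewrite fineK// ge0_fin_numE.
  (* This choice gives q * r' = (r + r') / 2, strictly between r' and r. *)
  pose q := (r + r') / (2 * r').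
  have q1 : 1 < q by rewrite /q ltr_pdivlMr ?mulr_gt0// mul1r; lra.
  have q0 : 0 < q by apply: lt_trans q1.
  have qr : q * r' < r.
    have -> : q * r' = (r + r') / 2 by rewrite /q; field; rewrite gt_eqF.
    lra.
  clearbody q; near=> n.
  have n0 : (0 < n)%N by near: n; exact: nbhs_infty_gt.
  rewrite Lnorm2E; apply: root_le => //; first exact: ltW.
    by apply: integral_ge0 => y _; rewrite lee_fin sqr_ge0.
  have hn : {ae nu, forall y, w y != 0 ->
    [/\ 0 <= K y, q ^- n * K y ^+ n <= h n y & h n y <= q ^+ n * K y ^+ n]}.
    by near: n; exact: hK.
  have big : fine C <= ((r / (q * r')) ^+ 2) ^+ n.
    near: n; apply: near_expr_ge.
    by rewrite expr_gt1 ?ltr_pdivlMr ?mulr_gt0 ?mul1r// divr_ge0 ?mulr_ge0 ?ltW.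
  apply: (@le_trans _ _ (((q * r') ^+ (2 * n))%:E * C)%E); last first.
    rewrite Cr -EFinM lee_fin mulrC -ler_pdivlMr ?exprn_gt0 ?mulr_gt0//.
    by rewrite -expr_div_n exprM.
  rewrite /C -ge0_integralZl; [|by []|by []
    |by move=> y _; rewrite lee_fin sqr_ge0
    |by rewrite lee_fin exprn_ge0// mulr_ge0 ?ltW].
  apply: ae_ge0_le_integral => //.
  + by move=> y _; rewrite lee_fin sqr_ge0.
  + by move=> y _; rewrite -EFinM lee_fin mulr_ge0 ?sqr_ge0// exprn_ge0// mulr_ge0 ?ltW.
  + exact/measurable_funeM.
  apply: filterS2 hn Kr => y hn Kr _; rewrite -EFinM lee_fin.
  have [->|wy] := eqVneq (w y) 0; first by rewrite mulr0 expr0n /= mulr0.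
  have [K0 lb ub] := hn wy.
  rewrite [leLHS]exprMn ler_wpM2r ?sqr_ge0// mulnC exprM.
  have h0 : 0 <= h n y.
    by apply: le_trans lb; rewrite mulr_ge0 ?exprn_ge0// invr_ge0 exprn_ge0// ltW.
  have qr0 : 0 <= (q * r') ^+ n by rewrite exprn_ge0// mulr_ge0// ltW.
  rewrite ler_sqr ?nnegrE//.
  apply: le_trans ub _; rewrite exprMn ler_wpM2l//.
    by rewrite exprn_ge0// ltW.
  by rewrite lerXn2r ?nnegrE ?Kr// ltW.
Unshelve. all: by end_near. Qed.

End NormRoots.

(** * Complex functions and vectors supported on sets of uniform convergence *)

Section ComplexFunctions.
Context (R : realType) (d : measure_display) (Y : measurableType d)
  (nu : probability Y R).
Implicit Types (phi xi eta : Y -> R[i]).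

Lemma modulus_ge0 phi y : 0 <= modulus phi y.
Proof. by rewrite /modulus; case: (phi y) => a b; exact: sqrtr_ge0. Qed.

Lemma modulus_eq0 phi y : (modulus phi y == 0) = (phi y == 0).
Proof.
apply/eqP/eqP => [|h]; first exact: ComplexField.Normc.eq0_normc.
by rewrite /modulus h ComplexField.Normc.normc0.
Qed.

Lemma modulusM phi xi y :
  modulus (fun y => phi y * xi y) y = modulus phi y * modulus xi y.
Proof. exact: ComplexField.Normc.normcM. Qed.

Lemma measurable_modulus phi : cmeasurable phi ->
  measurable_fun setT (modulus phi).
Proof.
move=> [mre mim].
rewrite (_ : modulus phi = Num.sqrt \o (fun y =>
    complex.Re (phi y) ^+ 2 + complex.Im (phi y) ^+ 2)).
  apply: measurableT_comp.
    by apply: continuous_measurable_fun => r; exact: sqrt_continuous.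
  by apply: measurable_funD; exact: measurable_funX.
by apply/funext => y; rewrite /modulus /=; case: (phi y).
Qed.

Lemma cmeasurableD phi xi : cmeasurable phi -> cmeasurable xi ->
  cmeasurable (fun y => phi y + xi y).
Proof.
move=> [pre pim] [xre xim]; split.
  under eq_fun do rewrite raddfD; exact: measurable_funD.
under eq_fun do rewrite raddfD; exact: measurable_funD.
Qed.

Lemma cmeasurableM phi xi : cmeasurable phi -> cmeasurable xi ->
  cmeasurable (fun y => phi y * xi y).
Proof.
move=> [pre pim] [xre xim]; split.
  rewrite (_ : (fun y => _) = (fun y => complex.Re (phi y) * complex.Re (xi y)
    - complex.Im (phi y) * complex.Im (xi y))).
    by apply: measurable_funB; exact: measurable_funM.
  by apply/funext => y; case: (phi y) => a b; case: (xi y).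
rewrite (_ : (fun y => _) = (fun y => complex.Re (phi y) * complex.Im (xi y)
  + complex.Im (phi y) * complex.Re (xi y))).
  by apply: measurable_funD; exact: measurable_funM.
by apply/funext => y; case: (phi y) => a b; case: (xi y).
Qed.

Lemma cmeasurable_cst (z : R[i]) : cmeasurable (fun _ : Y => z).
Proof. by split; exact: measurable_cst. Qed.

Lemma cmeasurable_real (g : Y -> R) : measurable_fun setT g ->
  cmeasurable (fun y => (g y)%:C).
Proof. by move=> mg; split => //=; exact: measurable_cst. Qed.

Lemma norm2_ltyP phi :
  (norm2 nu phi < +oo)%E <-> (\int[nu]_y (modulus phi y ^+ 2)%:E < +oo)%E.
Proof.
rewrite /norm2 Lnorm2E; split; first by apply: lty_poweRy.
exact: poweR_lty.
Qed.

Lemma L2_linear (z : R[i]) xi eta : L2 nu xi -> L2 nu eta ->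
  L2 nu (fun y => z * xi y + eta y).
Proof.
move=> [mxi /norm2_ltyP fxi] [meta /norm2_ltyP feta]; split.
  by apply: cmeasurableD => //; apply: cmeasurableM => //; exact: cmeasurable_cst.
apply/norm2_ltyP.
pose a := 2 * ComplexField.Normc.normc z ^+ 2.
have a0 : 0 <= a by rewrite mulr_ge0// sqr_ge0.
have m1 : measurable_fun setT (fun y => (modulus xi y ^+ 2)%:E).
  by apply/measurable_EFinP; apply: measurable_funX; exact: measurable_modulus.
have m2 : measurable_fun setT (fun y => (modulus eta y ^+ 2)%:E).
  by apply/measurable_EFinP; apply: measurable_funX; exact: measurable_modulus.
apply: (@le_lt_trans _ _ (\int[nu]_y
    (a%:E * (modulus xi y ^+ 2)%:E + 2%:E * (modulus eta y ^+ 2)%:E))%E); last first.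
  rewrite ge0_integralD//; last 4 first.
  - by move=> y _; rewrite -EFinM lee_fin mulr_ge0// sqr_ge0.
  - exact: measurable_funeM.
  - by move=> y _; rewrite -EFinM lee_fin mulr_ge0// sqr_ge0.
  - exact: measurable_funeM.
  rewrite !ge0_integralZl//; try by move=> y _; rewrite lee_fin sqr_ge0.
  by rewrite lte_add_pinfty// lte_mul_pinfty.
apply: ge0_le_integral => //.
- by move=> y _; rewrite lee_fin sqr_ge0.
- apply/measurable_EFinP; apply: measurable_funX; apply: measurable_modulus.
  by apply: cmeasurableD => //; apply: cmeasurableM => //; exact: cmeasurable_cst.
- by apply: emeasurable_funD; exact: measurable_funeM.
move=> y _; rewrite -!EFinM -EFinD lee_fin.
have tri : modulus (fun y => z * xi y + eta y) y <=
    ComplexField.Normc.normc z * modulus xi y + modulus eta y.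
  rewrite /modulus -ComplexField.Normc.normcM; exact: le_normcD.
have n0 := modulus_ge0 (fun y => z * xi y + eta y) y.
apply: (@le_trans _ _ ((ComplexField.Normc.normc z * modulus xi y + modulus eta y) ^+ 2)).
  by rewrite ler_sqr ?nnegrE// (le_trans n0).
rewrite /a -subr_ge0.
set p := _ z; set s := modulus xi y; set t := modulus eta y.
have -> : 2 * p ^+ 2 * s ^+ 2 + 2 * t ^+ 2 - (p * s + t) ^+ 2 = (p * s - t) ^+ 2.
  by ring.
exact: sqr_ge0.
Qed.

Lemma L2_restrict A xi : measurable A -> L2 nu xi ->
  L2 nu (fun y => \1_A y * xi y).
Proof.
move=> mA [mxi /norm2_ltyP fxi].
have mI : cmeasurable (fun y => \1_A y * xi y).
  apply: cmeasurableM => //.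
  rewrite (_ : \1_A = (fun y => (\1_A y : R)%:C)).
    exact: cmeasurable_real.
  by apply/funext => y; rewrite !indicE; case: (y \in A).
split => //; apply/norm2_ltyP; apply: le_lt_trans fxi.
apply: ge0_le_integral => //.
- by move=> y _; rewrite lee_fin sqr_ge0.
- by apply/measurable_EFinP; apply: measurable_funX; exact: measurable_modulus.
- by apply/measurable_EFinP; apply: measurable_funX; exact: measurable_modulus.
move=> y _; rewrite lee_fin /modulus indicE; case: (y \in A).
  by rewrite mul1r.
by rewrite mul0r ComplexField.Normc.normc0 expr0n sqr_ge0.
Qed.

(** Uniform convergence of u to g on A. *)
Definition uniformly_on (A : set Y) (u : nat -> Y -> R) (g : Y -> R) : Prop :=
  forall e : R, 0 < e ->
    \forall n \near \oo, forall y, A y -> `|u n y - g y| < e.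

Lemma uniformly_onP A u g : {uniform A, u @ \oo --> g} -> uniformly_on A u g.
Proof.
move=> ug e e0.
have := ug [set h | forall y, A y -> `|h y - g y| < e].
apply; apply/uniform_nbhs; exists [set xy | ball xy.1 e xy.2]; split.
  exact: entourage_ball (PosNum e0).
by move=> h /= hh y Ay; rewrite distrC; apply: hh.
Qed.

(** The square-integrable functions vanishing almost everywhere outside some
    measurable set on which u converges uniformly to g. *)
Definition uniform_vectors (u : nat -> Y -> R) (g : Y -> R) : set (Y -> R[i]) :=
  [set xi | L2 nu xi /\ exists A, [/\ measurable A, uniformly_on A u g &
    {ae nu, forall y, ~ A y -> xi y = 0}]].

Lemma uniform_vectors_subspace u g : L2_subspace nu (uniform_vectors u g).
Proof.
split.
- by move=> xi [].
- split.
    split; first exact: cmeasurable_cst.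
    apply/norm2_ltyP; rewrite integral0_eq// => y _.
    by rewrite /modulus ComplexField.Normc.normc0 expr0n.
  exists set0; split => //; last exact: nearW.
  by move=> e e0; apply: nearW.
- move=> z xi eta [Lxi [A [mA uA xiA]]] [Leta [B [mB uB etaB]]].
  split; first exact: L2_linear.
  exists (A `|` B); split; first exact: measurableU.
    move=> e e0; near=> n => y [Ay|By].
      by move: y Ay; near: n; exact: uA.
    by move: y By; near: n; exact: uB.
  apply: filterS2 xiA etaB => y hA hB /not_orP[nA nB].
  by rewrite hA// hB// mulr0 addr0.
- move=> xi eta [Lxi [A [mA uA xiA]]] Leta xieta; split => //.
  exists A; split => //.
  by apply: filterS2 xiA xieta => y h <-.
Unshelve. all: by end_near. Qed.

(** By Egorov's theorem. *)
Lemma uniform_vectors_dense (u : nat -> Y -> R) (g : Y -> R) :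
  (forall n, measurable_fun setT (u n)) -> measurable_fun setT g ->
  {ae nu, forall y, u n y @[n --> \oo] --> g y} ->
  essentially_dense nu (uniform_vectors u g).
Proof.
move=> mu mg ug; split; first exact: uniform_vectors_subspace.
move=> e e0.
have [||||||B [mB Be uB]] := @ae_pointwise_almost_uniform _ _ _ nu u g setT e.
- exact: mu.
- exact: mg.
- exact: measurableT.
- by rewrite /= probability_setT ltry.
- by apply: filterS ug => y uy _.
- exact: e0.
exists (~` B); split.
- exact: measurableC.
- rewrite (_ : (\int[nu]_y _)%E = nu B)//.
  rewrite -[in RHS](setIT B) -integral_indic//; apply: eq_integral => y _.
  by rewrite !indicE in_setC; case: (y \in B); rewrite /= ?subr0 ?subrr.
- move=> xi Lxi; split; first by apply: L2_restrict => //; exact: measurableC.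
  exists (~` B); split; first exact: measurableC.
    by apply: uniformly_onP; rewrite -setTD.
  by apply: nearW => y nB; rewrite indicE memNset// mul0r.
Qed.

(** Exponentiated form of ln l - ln q <= n^-1 ln h. *)
Lemma log_ratio_lower (q h l : R) (n : nat) : 0 < q -> 0 < h -> 0 < l ->
  (0 : R) < n%:R -> ln l <= n%:R^-1 * ln h + ln q -> q ^- n * l ^+ n <= h.
Proof.
move=> q0 h0 l0 n0 hl.
have qn : 0 < q ^+ n by rewrite exprn_gt0.
have ln0 : 0 < l ^+ n by rewrite exprn_gt0.
rewrite mulrC ler_pdivrMr// -ler_ln ?posrE ?mulr_gt0//.
rewrite lnM ?posrE// !lnXn//.
rewrite -[X in X <= _]mulr_natl -[X in _ <= _ + X]mulr_natl.
have -> : ln h = n%:R * (n%:R^-1 * ln h) by rewrite mulrA mulfV ?mul1r ?gt_eqF.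
by rewrite -mulrDr ler_pM2l.
Qed.

(** Exponentiated form of n^-1 ln h <= ln l + ln q. *)
Lemma log_ratio_upper (q h l : R) (n : nat) : 0 < q -> 0 < h -> 0 < l ->
  (0 : R) < n%:R -> n%:R^-1 * ln h - ln q <= ln l -> h <= q ^+ n * l ^+ n.
Proof.
move=> q0 h0 l0 n0 hl.
have qn : 0 < q ^+ n by rewrite exprn_gt0.
have ln0 : 0 < l ^+ n by rewrite exprn_gt0.
rewrite -ler_ln ?posrE ?mulr_gt0//.
rewrite lnM ?posrE// !lnXn//.
rewrite -[X in _ <= X + _]mulr_natl -[X in _ <= _ + X]mulr_natl.
have -> : ln h = n%:R * (n%:R^-1 * ln h) by rewrite mulrA mulfV ?mul1r ?gt_eqF.
by rewrite -mulrDr ler_pM2l// addrC -lerBlDr.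
Qed.

Lemma uniform_vectors_limit (c : nat -> Y -> R[i]) (L : Y -> R) xi :
  (forall n, cmeasurable (c n)) ->
  (forall n, {ae nu, forall y, c n y != 0}) ->
  measurable_fun setT L -> {ae nu, forall y, 0 < L y} ->
  uniform_vectors (fun n y => n%:R^-1 * log_modulus (c n) y) (fun y => ln (L y)) xi ->
  (norm2 nu (fun y => c n y * xi y)%R `^ n%:R^-1)%E @[n --> \oo] -->
    weighted_ess_sup nu L (modulus xi) /\
  (norm2 nu (fun y => (L y ^+ n)%:C * xi y)%R `^ n%:R^-1)%E @[n --> \oo] -->
    weighted_ess_sup nu L (modulus xi).
Proof.
move=> mc c0 mL L0 [[mxi /norm2_ltyP fxi] [A [mA uA xiA]]].
have mw := measurable_modulus mxi.
have c0' : {ae nu, forall y, forall n, c n y != 0} by apply/ae_foralln.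
split.
  under eq_fun => n.
    rewrite /norm2 (_ : EFin \o modulus _ =
      EFin \o (fun y => modulus (c n) y * modulus xi y)%R); last first.
      by apply/funext => y /=; rewrite modulusM.
    over.
  apply: cvg_Lnorm2_root => //.
    by move=> n; exact: measurable_modulus.
  move=> q q1; have q0 : 0 < q by apply: lt_trans q1.
  have lnq : 0 < ln q by rewrite ln_gt0.
  near=> n.
  have n0 : (0 : R) < n%:R by rewrite ltr0n; near: n; exact: nbhs_infty_gt.
  have un : forall y, A y -> `|n%:R^-1 * log_modulus (c n) y - ln (L y)| < ln q.
    by near: n; exact: uA.
  apply: filterS3 c0' L0 xiA => y cy Ly Ay wy.
  have {}Ay : A y.
    by apply: contrapT => /Ay xi0; move: wy; rewrite modulus_eq0 xi0 eqxx.
  have h0 : 0 < modulus (c n) y by rewrite lt_neqAle modulus_ge0 eq_sym modulus_eq0 cy.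
  have := un _ Ay; rewrite /log_modulus ltr_distlC => /andP[lo up].
  split; first exact: ltW.
    by apply: (log_ratio_lower q0 h0 Ly n0); exact: ltW.
  by apply: (log_ratio_upper q0 h0 Ly n0); exact: ltW.
under eq_fun => n.
  rewrite /norm2 (_ : EFin \o modulus _ =
    EFin \o (fun y => modulus (fun y => (L y ^+ n)%:C) y * modulus xi y)%R); last first.
    by apply/funext => y /=; rewrite modulusM.
  over.
apply: cvg_Lnorm2_root => //.
  by move=> n; apply/measurable_modulus/cmeasurable_real; exact: measurable_funX.
move=> q q1; near=> n; apply: filterS L0 => y Ly wy.
have -> : modulus (fun y => (L y ^+ n)%:C) y = L y ^+ n.
  by rewrite /modulus /= expr0n /= addr0 sqrtr_sqr ger0_norm// exprn_ge0// ltW.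
have Ln0 : 0 <= L y ^+ n by rewrite exprn_ge0// ltW.
split; first exact: ltW.
  by rewrite ler_piMl// invf_le1 ?exprn_ege1 ?exprn_gt0 ?(lt_trans _ q1)// ltW.
by rewrite ler_peMl// exprn_ege1// ltW.
Unshelve. all: by end_near. Qed.

End ComplexFunctions.

(** * A countable dense family in L^1 *)

Section CountablyGenerated.
Context (R : realType) (d : measure_display) (Y : measurableType d).

(** The sigma-algebra is generated by a sequence of sets. *)
Definition countably_generated : Prop :=
  exists B : nat -> set Y, @measurable _ Y = <<s range B >>.

(** The generators are the preimages of the interiors of the balls of radius
    1/(n+1) centred in a countable dense set. *)
Lemma standard_borel_countably_generated :
  standard_borel R Y -> countably_generated.
Proof.
move=> [P [e [be _ [D /pfcard_geP Dc Dd] mE]]].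
have [a Da] : exists a : nat -> P, D `<=` range a.
  case: Dc => [->|[a]]; first by exists (fun=> e point).
  by exists a => x Dx; have [n _ <-] := @surj _ _ _ _ a x Dx; exists n.
pose U k : set P := if @unpickle (nat * nat)%type k is Some (i, n)
  then interior (ball (a i) n.+1%:R^-1) else set0.
have oU k : open (U k).
  by rewrite /U; case: unpickle => [[i n]|]; [exact: open_interior|exact: open0].
have UE (V : set P) : open V -> V = \bigcup_(k in [set k | U k `<=` V]) U k.
  move=> oV; apply/seteqP; split => [x Vx|x [k /= kV Ukx]]; last exact: kV.
  have /nbhs_ballP[r /= r0 rV] : nbhs x V by apply: open_nbhs_nbhs.
  have [n _ /(_ n (leqnn _)) /= nr] := near_infty_natSinv_lt (PosNum (divr_gt0 r0 (ltr0n R 2))).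
  have n0 : 0 < n.+1%:R^-1 / 2 :> R by rewrite divr_gt0 ?invr_gt0.
  have [y [/interior_subset xy Dy]] : interior (ball x (n.+1%:R^-1 / 2)) `&` D !=set0.
    apply: Dd; last exact: open_interior.
    by exists x; exact: (nbhsx_ballx x _ n0).
  have [i _ ay] := Da _ Dy.
  exists (pickle (i, n)).
    rewrite /= /U pickleK => z /interior_subset; rewrite ay => yz; apply: rV.
    apply: (@le_ball _ _ _ (n.+1%:R^-1 / 2 + n.+1%:R^-1)).
      have nr' : (n.+1%:R^-1 : R) < r / 2 := nr.
      move: nr' r0; move: (n.+1%:R^-1 : R) => q; move: (r : R) => r'; lra.
    exact: ball_triangle yz.
  rewrite /U pickleK ay; apply/nbhs_ballP; exists (n.+1%:R^-1 / 2) => //= z xz.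
  rewrite [n.+1%:R^-1]splitr; apply: ball_triangle xz; exact: ball_sym.
case: (be) => g eg ge.
have image_preimage V : e @` (e @^-1` V) = V.
  by apply/seteqP; split => [_ [y Vy <-]//|x Vx]; exists (g x); rewrite /= ge.
have preimage_image A : e @^-1` (e @` A) = A.
  apply/seteqP; split => [y [z Az /(can_inj eg) <-]//|y Ay]; by exists y.
exists (fun k => e @^-1` U k).
have mU k : measurable (e @^-1` U k).
  by apply/mE; rewrite image_preimage; apply: sub_gen_smallest; exact: oU.
apply/seteqP; split => A.
  move=> /mE.
  suff h : <<s [set V : set P | open V] >> `<=`
      [set V | <<s range (fun k => e @^-1` U k) >> (e @^-1` V)].
    by move=> /h /=; rewrite preimage_image.
  have [s0 sD sU] := smallest_sigma_algebra setT (range (fun k => e @^-1` U k)).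
  apply: smallest_sub.
    split => [//|V /= hV|F hF] /=.
    - by rewrite setTD; have := sD _ hV; rewrite setTD.
    - by rewrite preimage_bigcup; exact: sU.
  move=> V /= oV; rewrite (UE V oV) preimage_bigcup.
  rewrite bigcup_mkcond; apply: sU => k; case: ifP => // _.
  by apply: sub_gen_smallest; exists k.
have : <<s range (fun k => e @^-1` U k) >> `<=` @measurable _ Y.
  apply: smallest_sub; last by move=> _ [k _ <-].
  split => [//|V hV|F hF]; first by rewrite setTD; exact: measurableC.
  exact: bigcupT_measurable.
by apply.
Qed.

End CountablyGenerated.

Section L1.
Context (R : realType) (d : measure_display) (Y : measurableType d)
  (nu : probability Y R).

Lemma L1_triangle (u v w : Y -> R) (a b e : R) : measurable_fun setT u ->
  measurable_fun setT v -> measurable_fun setT w ->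
  (\int[nu]_y `|u y - v y|%:E < a%:E)%E ->
  (\int[nu]_y `|v y - w y|%:E <= b%:E)%E -> a + b <= e ->
  (\int[nu]_y `|u y - w y|%:E < e%:E)%E.
Proof.
move=> mu mv mw ha hb abe.
have mN (f g : Y -> R) : measurable_fun setT f -> measurable_fun setT g ->
    measurable_fun setT (fun y => `|f y - g y|%:E).
  move=> mf mg; apply/measurable_EFinP; apply: measurableT_comp => //.
  exact: measurable_funB.
apply: (@le_lt_trans _ _
    (\int[nu]_y `|u y - v y|%:E + \int[nu]_y `|v y - w y|%:E)%E).
  rewrite -ge0_integralD//; [|exact: mN|exact: mN].
  apply: ge0_le_integral => //; [exact: mN| |].
    by apply: emeasurable_funD; exact: mN.
  move=> y _; rewrite -EFinD lee_fin.
  have -> : u y - w y = (u y - v y) + (v y - w y) by ring.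
  exact: ler_normD.
apply: (@lt_le_trans _ _ (a + b)%:E); last by rewrite lee_fin.
rewrite EFinD lte_leD// ge0_fin_numE; last exact: integral_ge0.
by rewrite (le_lt_trans hb)// ltry.
Qed.

End L1.

Section CountableDense.
Import HBSimple.
Context (R : realType) (d : measure_display) (Y : measurableType d)
  (nu : probability Y R) (B : nat -> set Y).
Hypothesis YB : @measurable _ Y = <<s range B >>.

(** The finite intersections of generators, a pi-system; the empty list gives the
    whole space. *)
Definition cylinder (s : seq nat) : set Y :=
  [set y | forall k, k \in s -> B k y].

Lemma cylinder_cat s t : cylinder (s ++ t) = cylinder s `&` cylinder t.
Proof.
apply/seteqP; split => y /=.
  by move=> h; split => k ks; apply: h; rewrite mem_cat ks ?orbT.
by move=> [h1 h2] k; rewrite mem_cat => /orP[/h1|/h2].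
Qed.

Lemma measurable_generator k : measurable (B k).
Proof. by rewrite YB; apply: sub_gen_smallest; exists k. Qed.

Lemma measurable_cylinder s : measurable (cylinder s).
Proof.
elim: s => [|k s IH].
  rewrite (_ : cylinder [::] = setT)//; by apply/seteqP; split.
rewrite -cat1s cylinder_cat; apply: measurableI => //.
rewrite (_ : cylinder [:: k] = B k); first exact: measurable_generator.
apply/seteqP; split => y /=; first by apply; rewrite mem_head.
by move=> By j; rewrite inE => /eqP ->.
Qed.

(** Rational combinations of indicators of cylinders, encoded by finite lists so
    that they form a countable family. *)
Definition rational_step (p : seq (rat * seq nat)) (y : Y) : R :=
  \sum_(t <- p) ratr t.1 * \1_(cylinder t.2) y.

Lemma measurable_rational_step p : measurable_fun setT (rational_step p).
Proof.
rewrite /rational_step; apply: measurable_sum => t.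
apply: measurable_funM; first exact: measurable_cst.
exact/measurable_indicP/measurable_cylinder.
Qed.

Lemma rational_step_cat p q y :
  rational_step (p ++ q) y = rational_step p y + rational_step q y.
Proof. by rewrite /rational_step big_cat. Qed.

Lemma rational_step_scale (r : rat) p y :
  rational_step [seq (r * t.1, t.2) | t <- p] y = ratr r * rational_step p y.
Proof.
rewrite /rational_step big_map mulr_sumr; apply: eq_bigr => t _ /=.
by rewrite rmorphM mulrA.
Qed.

(** Membership in the L^1-closure of the rational step functions. *)
Definition step_approx (u : Y -> R) : Prop :=
  measurable_fun setT u /\ forall e : R, 0 < e ->
    exists p, (\int[nu]_y `|u y - rational_step p y|%:E < e%:E)%E.

Lemma step_approx_lim (u : Y -> R) : measurable_fun setT u ->
  (forall e : R, 0 < e -> exists2 v, step_approx v &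
    (\int[nu]_y `|u y - v y|%:E < e%:E)%E) -> step_approx u.
Proof.
move=> mu h; split => // e e0.
have e2 : 0 < e / 2 by rewrite divr_gt0.
have [v [mv hv] uv] := h _ e2.
have [p hp] := hv _ e2.
exists p; apply: L1_triangle uv (ltW hp) _ => //; first exact: measurable_rational_step.
by rewrite -splitr.
Qed.

Lemma step_approx_rational p : step_approx (rational_step p).
Proof.
split => [|e e0]; first exact: measurable_rational_step.
exists p; rewrite integral0_eq ?lte_fin// => y _; by rewrite subrr normr0.
Qed.

Lemma step_approxD u v : step_approx u -> step_approx v ->
  step_approx (fun y => u y + v y).
Proof.
move=> [mu hu] [mv hv]; split => [|e e0]; first exact: measurable_funD.
have e2 : 0 < e / 2 by rewrite divr_gt0.
have [p hp] := hu _ e2; have [q hq] := hv _ e2.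
exists (p ++ q).
have mp := measurable_rational_step p; have mq := measurable_rational_step q.
apply: (@L1_triangle _ _ _ nu _ (fun y => rational_step p y + v y) _ (e / 2) (e / 2)).
- exact: measurable_funD.
- exact: measurable_funD.
- exact: measurable_rational_step.
- under eq_integral => y _.
    rewrite [X in `|X|](_ : _ = u y - rational_step p y); last by ring.
    over.
  exact: hp.
- under eq_integral => y _.
    rewrite rational_step_cat [X in `|X|](_ : _ = v y - rational_step q y); last by ring.
    over.
  exact: ltW.
- by rewrite -splitr.
Qed.

Lemma step_approx0 : step_approx (fun=> 0).
Proof.
have := step_approx_rational [::]; congr step_approx.
by apply/funext => y; rewrite /rational_step big_nil.
Qed.

Lemma step_approx1 : step_approx (fun=> 1).
Proof.
have := step_approx_rational [:: (1, [::])]; congr step_approx.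
apply/funext => y; rewrite /rational_step big_seq1 rmorph1 mul1r indicE mem_set//.
Qed.

Lemma step_approx_rscale (r : rat) u : step_approx u ->
  step_approx (fun y => ratr r * u y).
Proof.
move=> [mu hu]; split => [|e e0].
  by apply: measurable_funM => //; exact: measurable_cst.
have r0 : 0 < `|ratr r : R| + 1 by rewrite ltr_wpDl.
have [p hp] := hu (e / (`|ratr r| + 1)) (divr_gt0 e0 r0).
exists [seq (r * t.1, t.2) | t <- p].
under eq_integral => y _.
  rewrite rational_step_scale -mulrBr normrM EFinM; over.
rewrite ge0_integralZl//; last first.
  apply/measurable_EFinP; apply: measurableT_comp => //.
  by apply: measurable_funB => //; exact: measurable_rational_step.
have I0 : (0 <= \int[nu]_y `|u y - rational_step p y|%:E)%E by exact: integral_ge0.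
apply: (@le_lt_trans _ _ ((`|ratr r| + 1)%:E * \int[nu]_y `|u y - rational_step p y|%:E)%E).
  by apply: lee_wpmul2r => //; rewrite lee_fin lerDl.
by rewrite muleC -lte_pdivlMr// muleC -EFinM mulrC.
Qed.

Lemma step_approx_scale (c : R) u : step_approx u ->
  (\int[nu]_y `|u y|%:E < +oo)%E -> step_approx (fun y => c * u y).
Proof.
move=> au ufin; have [mu _] := au.
apply: step_approx_lim => [|e e0].
  by apply: measurable_funM => //; exact: measurable_cst.
have I0 : (0 <= \int[nu]_y `|u y|%:E)%E by exact: integral_ge0.
set I := (\int[nu]_y `|u y|%:E)%E in ufin I0 *.
have IE : I = (fine I)%:E by rewrite fineK// ge0_fin_numE.
have f0 : 0 <= fine I by exact: fine_ge0.
have f1 : 0 < fine I + 1 by rewrite ltr_wpDl.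
have cc : c < c + e / (fine I + 1) by rewrite ltrDl divr_gt0.
have [r] := rat_in_itvoo cc.
rewrite in_itv /= => /andP[cr rc].
exists (fun y => ratr r * u y); first exact: step_approx_rscale.
under eq_integral => y _ do rewrite -mulrBl normrM EFinM.
rewrite ge0_integralZl//; last first.
  by apply/measurable_EFinP; exact: measurableT_comp.
rewrite -/I IE -EFinM lte_fin.
have d0 : `|c - ratr r| <= e / (fine I + 1).
  by rewrite ler_norml; apply/andP; split; move: (divr_gt0 e0 f1); lra.
apply: le_lt_trans (ler_wpM2r f0 d0) _.
rewrite mulrAC ltr_pdivrMr// ltr_pM2l// ltrDl//.
Qed.

Lemma step_approx_sum (I : Type) (s : seq I) (v : I -> Y -> R) :
  (forall i, step_approx (v i)) -> step_approx (fun y => \sum_(i <- s) v i y).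
Proof.
move=> h; elim: s => [|i s IH].
  by under eq_fun do rewrite big_nil; exact: step_approx0.
by under eq_fun do rewrite big_cons; apply: step_approxD.
Qed.

(** By the pi-lambda theorem. *)
Lemma step_approx_indic (A : set Y) : measurable A -> step_approx \1_A.
Proof.
have YC : @measurable _ Y = <<s range cylinder >>.
  have sC := smallest_sigma_algebra setT (range cylinder).
  apply/seteqP; split.
    rewrite YB; apply: smallest_sub => // _ [k _ <-]; apply: sub_gen_smallest.
    exists [:: k] => //; apply/seteqP; split => y /=.
      by apply; rewrite mem_head.
    by move=> By j; rewrite inE => /eqP ->.
  apply: smallest_sub; last by move=> _ [s _ <-]; exact: measurable_cylinder.
  split => [//|V hV|F hF]; first by rewrite setTD; exact: measurableC.
  exact: bigcupT_measurable.
rewrite YC; move: A; apply: dynkin_induction => //.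
- by move=> _ _ [s _ <-] [t _ <-]; exists (s ++ t) => //; rewrite cylinder_cat.
- by rewrite indicT; exact: step_approx1.
- move=> _ [s _ <-]; have := step_approx_rational [:: (1, s)].
  congr step_approx; apply/funext => y.
  by rewrite /rational_step big_seq1 rmorph1 mul1r.
- move=> S mS aS.
  have -> : \1_(~` S) = (fun y => 1 + ratr (-1) * \1_S y) :> (Y -> R).
    apply/funext => y; rewrite rmorphN1 mulN1r !indicE in_setC.
    by case: (y \in S); rewrite /= ?subrr ?subr0.
  by apply: step_approxD; [exact: step_approx1|exact: step_approx_rscale].
- move=> F mF tF aF.
  have mU : measurable (\bigcup_k F k) by exact: bigcupT_measurable.
  apply: step_approx_lim; first exact/measurable_indicP.
  move=> e e0.
  pose v n y : R := \sum_(i < n) \1_(F i) y.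
  have mv n : measurable_fun setT (v n).
    by apply: measurable_sum => i; exact/measurable_indicP.
  have vE n y : v n y = \1_(\bigcup_(k in `I_n) F k) y.
    elim: n => [|n IH]; first by rewrite /v big_ord0 II0 bigcup_set0 indic0.
    rewrite /v big_ord_recr /= -/(v n y) IH !indicE.
    have [Fn|nFn] := pselect (F n y).
      rewrite (mem_set Fn) [y \in \bigcup_(k in `I_n.+1) _]mem_set; last by exists n => /=.
      rewrite memNset ?add0r// => -[k /= kn Fk].
      have kE := tF k n I I (ex_intro _ y (conj Fk Fn)).
      by rewrite kE ltnn in kn.
    rewrite (memNset nFn) addr0.
    have [[k /= kn Fk]|nU] := pselect ((\bigcup_(k in `I_n) F k) y).
      rewrite !mem_set//; first by exists k => //=; exact: ltnW.
      by exists k.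
    rewrite !memNset// => -[k /=]; rewrite ltnS leq_eqVlt => /orP[/eqP ->//|kn Fk].
    by apply: nU; exists k.
  have [|||||_ cv _] := @dominated_convergence _ _ _ nu setT measurableT
    (fun n y => (v n y)%:E) (fun y => (\1_(\bigcup_k F k) y)%:E) (cst 1%E).
  + by move=> n; exact/measurable_EFinP.
  + by apply/measurable_EFinP/measurable_indicP.
  + apply: nearW => y _; apply: cvg_near_cst.
    have [[k _ Fk]|nF] := pselect ((\bigcup_k F k) y).
      exists k.+1 => // n /= kn; rewrite vE !indicE !mem_set//; first by exists k.
      by exists k.
    apply: nearW => n; rewrite vE !indicE !memNset// => -[k _ Fk]; apply: nF.
    by exists k.
  + exact: finite_measure_integrable_cst.
  + apply: nearW => y n _; rewrite /= vE lee_fin indicE.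
    by case: (_ \in _); rewrite ?normr1 ?normr0.
  have : \forall n \near \oo,
      (\int[nu]_y `|(v n y)%:E - (\1_(\bigcup_k F k) y)%:E| < e%:E)%E.
    by have := cv [set z | (z < e%:E)%E]; apply; apply: open_ereal_lt'; rewrite lte_fin.
  move=> [n _ /(_ n (leqnn _)) /= hn].
  exists (v n); first exact: step_approx_sum.
  by under eq_integral => y _ do rewrite distrC.
Qed.

Lemma step_approx_sfun (g : {sfun Y >-> R}) : step_approx g.
Proof.
rewrite (_ : (g : Y -> R) = (fun y => \sum_(r <- finmap.enum_fset (fset_set (range g)))
    (r * \1_(g @^-1` [set r]) y))).
  apply: step_approx_sum => r.
  have mA : measurable (g @^-1` [set r]) by [].
  apply: step_approx_scale; first exact: step_approx_indic.
  under eq_integral do rewrite ger0_norm//.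
  by rewrite integral_indic// setIT; apply: le_lt_trans (probability_le1 nu mA) (ltry _).
by apply/funext => y; rewrite fimfunE fsbig_finite.
Qed.

Lemma step_approx_integrable (u : Y -> R) : nu.-integrable setT (EFin \o u) ->
  step_approx u.
Proof.
move=> iu; have mu : measurable_fun setT u.
  by apply/measurable_EFinP; case/integrableP: iu.
have [g [_ _ gu]] := approximation_sfun_integrable measurableT iu.
apply: step_approx_lim => // e e0.
have : \forall n \near \oo,
    (\int[nu]_y `|(u y)%:E - (g n y)%:E| < e%:E)%E.
  by have := gu [set z | (z < e%:E)%E]; apply; apply: open_ereal_lt'; rewrite lte_fin.
move=> [N _ /(_ N (leqnn _))] /= gN.
by exists (g N) => //; exact: step_approx_sfun.
Qed.

End CountableDense.

(** * Jointly measurable versions *)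

Section JointVersion.
Context (R : realType) (dX dY : measure_display) (X : measurableType dX)
  (Y : measurableType dY) (nu : probability Y R).

(** Summability of the L^1 distances makes the series of |v - u_j| finite almost
    everywhere. *)
Lemma ae_cvg_of_summable (u : nat -> Y -> R) (v : Y -> R) :
  (forall j, measurable_fun setT (u j)) -> measurable_fun setT v ->
  (forall j, \int[nu]_y `|v y - u j y|%:E <= (2 ^- j.+1)%:E)%E ->
  {ae nu, forall y, u j y @[j --> \oo] --> v y}.
Proof.
move=> mu mv uv.
have mN j : measurable_fun setT (fun y => `|v y - u j y|%:E).
  by apply/measurable_EFinP; apply: measurableT_comp => //; exact: measurable_funB.
pose S y := (\sum_(0 <= j <oo) `|v y - u j y|%:E)%E.
have mS : measurable_fun setT S by apply: ge0_emeasurable_sum.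
have iS : nu.-integrable setT S.
  apply/integrableP; split => //.
  under eq_integral => y _ do rewrite gee0_abs ?nneseries_ge0//.
  rewrite integral_nneseries//.
  apply: (@le_lt_trans _ _ (\sum_(0 <= j <oo) (1 / (2 ^ (j + 1))%:R : R)%:E)%E).
    apply: lee_nneseries => [j _ _|j _]; first exact: integral_ge0.
    by rewrite (le_trans (uv j))// lee_fin addn1 natrX div1r.
  by have := @cvg_geometric_eseries_half R 1 0 => /cvg_lim -> //; rewrite ltry.
have := integrable_ae measurableT iS.
apply: filterS => y /(_ I) Sfin.
have Slt : (S y < +oo)%E by rewrite ltey_eq Sfin.
have tail := @nneseries_tail_cvg R (fun j => `|v y - u j y|%:E)%E xpredT Slt
  (fun _ _ => normr_ge0 _).
apply/cvgrPdist_lt => e e0.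
have : \forall N \near \oo, (\sum_(N <= k <oo) `|v y - u k y|%:E < e%:E)%E.
  by have := tail [set z | (z < e%:E)%E]; apply; apply: open_ereal_lt'; rewrite lte_fin.
apply: filterS => N; rewrite -lte_fin; apply: le_lt_trans.
have := @nneseries_lim_ge R (fun j => `|v y - u j y|%:E)%E xpredT N N.+1.
by rewrite big_nat1; apply.
Qed.

(** For each x and j, take the first member of the dense sequence g within
    2^-(j+1) of h x; the upper limit over j is the joint version. *)
Lemma joint_version (h : X -> Y -> R) (g : nat -> Y -> R) :
  (forall x, measurable_fun setT (h x)) ->
  (forall k, measurable_fun setT (g k)) ->
  (forall x (e : R), 0 < e ->
    exists k, (\int[nu]_y `|h x y - g k y|%:E < e%:E)%E) ->
  (forall k (r : R),
    measurable [set x | (\int[nu]_y `|h x y - g k y|%:E < r%:E)%E]) ->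
  exists2 H : X * Y -> R, measurable_fun setT H &
    forall x, {ae nu, forall y, H (x, y) = h x y}.
Proof.
move=> mh mg dense_g mclose.
pose close j k := [set x | (\int[nu]_y `|h x y - g k y|%:E < (2 ^- j.+1)%:E)%E].
have exclose j x : exists k, `[< close j k x >].
  have [|k hk] := dense_g x (2 ^- j.+1); first by rewrite invr_gt0 exprn_gt0.
  by exists k; apply/asboolP.
pose sel j x := ex_minn (exclose j x).
have msel j k : measurable [set x | sel j x = k].
  rewrite (_ : [set x | _] = close j k `\` \bigcup_(i in `I_k) close j i).
    apply: measurableD; first exact: mclose.
    by apply: bigcup_measurable => i _; exact: mclose.
  apply/seteqP; split => x /=; rewrite /sel; case: ex_minnP => m /asboolP hm hmin.
    move=> <-; split => // -[i /= im hi].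
    by have := hmin i (asboolT hi); rewrite leqNgt im.
  move=> [hk nk]; apply/eqP; rewrite eqn_leq hmin ?(asboolT hk)//= leqNgt.
  by apply/negP => mk; apply: nk; exists m.
pose Hj j (xy : X * Y) := g (sel j xy.1) xy.2.
have mHj j : measurable_fun setT (Hj j).
  have -> : [set: X * Y] = \bigcup_k ([set x | sel j x = k] `*` [set: Y]).
    by apply/seteqP; split => // -[x y] _; exists (sel j x).
  apply/measurable_fun_bigcup => k; first exact: measurableX.
  apply: (@eq_measurable_fun _ _ _ _ _ (g k \o snd)).
    by move=> [x y]; rewrite inE => -[/= <- _].
  apply: (@measurable_funS _ _ _ _ setT) => //.
  by apply: measurableT_comp => //; exact: measurable_snd.
exists (fun xy => fine (limn_esup (fun j => (Hj j xy)%:E))).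
  apply: measurableT_comp; first exact: fine_measurable.
  by apply: measurable_fun_limn_esup => j; exact/measurable_EFinP.
move=> x.
have := @ae_cvg_of_summable (fun j => g (sel j x)) (h x) (fun j => mg _) (mh x).
have hsel j : (\int[nu]_y `|h x y - g (sel j x) y|%:E <= (2 ^- j.+1)%:E)%E.
  by rewrite /sel; case: ex_minnP => m /asboolP hm _; exact: ltW.
move=> /(_ hsel); apply: filterS => y cy.
rewrite (@cvg_limn_einf_sup _ _ (h x y)%:E _).2//.
by apply/fine_cvgP; split; [exact: nearW|exact: cy].
Qed.

End JointVersion.

(** * Consequences of measurability for the strong operator topology *)

Section SOT.
Context (R : realType) (dX dY : measure_display) (X : measurableType dX)
  (Y : measurableType dY) (nu : probability Y R).

Lemma L1_le_Lnorm2 (u : Y -> R) : measurable_fun setT u ->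
  (\int[nu]_y `|u y|%:E <= 'N[nu]_2%:E [EFin \o u])%E.
Proof.
move=> mu.
have h2 : (2^-1 + 2^-1 = 1 :> R) by rewrite [RHS]splitr mul1r.
have := @hoelder _ _ _ nu u (cst 1) 2 2 mu (measurable_cst _) (ltr0n _ _) (ltr0n _ _) h2.
rewrite Lnorm1 (_ : EFin \o cst 1 = cst 1%E)//.
rewrite Lnorm_cst1 /= probability_setT poweR1r mule1.
by under eq_integral => y _ do rewrite /= mulr1.
Qed.

Lemma Linfty_integrable (phi : Y -> R[i]) : Linfty nu phi ->
  nu.-integrable setT (EFin \o modulus phi).
Proof.
move=> [mphi phiy].
have mm := measurable_modulus mphi.
apply/Lfun1_integrable.
have nfin : (nu : {measure set Y -> \bar R}) [set: Y] \is a fin_num.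
  by rewrite /= probability_setT.
apply: (@Lfun_subset _ _ _ nu 1%E +oo%E (lexx _) (leey _) nfin (leey _)).
by apply/andP; split; rewrite inE.
Qed.

Lemma modulus_dist (a b : Y -> R[i]) y :
  `|modulus b y - modulus a y| <= modulus (fun y => b y - a y) y.
Proof.
have tri (u v : R[i]) : ComplexField.Normc.normc u <=
    ComplexField.Normc.normc v + ComplexField.Normc.normc (u - v).
  by rewrite -{1}(subrK v u) [u - v + v]addrC; exact: le_normcD.
rewrite ler_distl /modulus; apply/andP; split; last exact: tri.
rewrite lerBlDr -[X in _ + X](normcN (b y - a y : Rcomplex R)) opprB.
exact: tri.
Qed.

(** The test vector is the constant function 1: for b near a in the strong
    operator topology, |b| is near |a| in L^2, hence in L^1. *)
Lemma sot_open_L1_ball (g : Y -> R) (r : R) : measurable_fun setT g ->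
  sot_open nu [set b | Linfty nu b /\
    (\int[nu]_y `|modulus b y - g y|%:E < r%:E)%E].
Proof.
move=> mg; split => [b [] //|a [La ar]].
have [ma _] := La.
have mma := measurable_modulus ma.
set I := (\int[nu]_y _)%E in ar.
have I0 : (0 <= I)%E by exact: integral_ge0.
have IE : I = (fine I)%:E by rewrite fineK// ge0_fin_numE// (lt_trans ar)// ltry.
exists 1%N, (fun _ _ => 1), (r - fine I); split.
- by rewrite subr_gt0 -lte_fin -IE.
- move=> _; split; first exact: cmeasurable_cst.
  apply/norm2_ltyP; under eq_integral => y _ do
    rewrite /modulus ComplexField.Normc.normc1 expr1n.
  by rewrite integral_cst//= mul1e probability_setT ltry.
move=> b Lb /(_ ord0) bar; split => //.
have [mb _] := Lb; have mmb := measurable_modulus mb.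
apply: (@L1_triangle _ _ _ nu _ (modulus a) _ (r - fine I) (fine I)) => //.
- apply: le_lt_trans bar; rewrite /norm2.
  have mba : measurable_fun setT (modulus (fun y => (b y - a y) * 1)).
    apply: measurable_modulus; apply: cmeasurableM; last exact: cmeasurable_cst.
    apply: cmeasurableD => //; case: ma => ma1 ma2; split.
      by under eq_fun do rewrite raddfN; exact: measurable_funN.
    by under eq_fun do rewrite raddfN; exact: measurable_funN.
  apply: le_trans (L1_le_Lnorm2 mba); apply: ge0_le_integral => //.
  + apply/measurable_EFinP; apply: measurableT_comp => //; exact: measurable_funB.
  + by apply/measurable_EFinP; exact: measurableT_comp.
  move=> y _; rewrite lee_fin [leRHS]ger0_norm ?modulus_ge0//.
  by rewrite (le_trans (modulus_dist a b y))// /modulus mulr1.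
- by rewrite -/I -IE.
- by rewrite subrK.
Qed.

Lemma sot_measurable_L1_ball (c : X -> Y -> R[i]) (g : Y -> R) (r : R) :
  sot_measurable nu c -> (forall x, Linfty nu (c x)) -> measurable_fun setT g ->
  measurable [set x | (\int[nu]_y `|modulus (c x) y - g y|%:E < r%:E)%E].
Proof.
move=> mc Lc mg; have := mc _ (sot_open_L1_ball r mg).
congr (measurable _); apply/seteqP; split => x //=; by case.
Qed.

End SOT.

(** * Fibrewise convergence and identification of the limit *)

Section EinfPositive.
Context (R : realType).

Lemma limn_einf_ge0 (u : nat -> \bar R) :
  (forall n, 0 <= u n)%E -> (0 <= limn_einf u)%E.
Proof.
move=> u0; rewrite limn_einf_lim; apply: lime_ge; first exact: is_cvg_einfs.
by apply: nearW => n; apply: le_ereal_inf_tmp => _ [k _ <-].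
Qed.

Lemma limn_esup_ge0 (u : nat -> \bar R) :
  (forall n, 0 <= u n)%E -> (0 <= limn_esup u)%E.
Proof. by move=> u0; rewrite (le_trans _ (limn_einf_sup u))// limn_einf_ge0. Qed.

End EinfPositive.

Section Ergodic.
Context (R : realType) (dX dY : measure_display) (X : measurableType dX)
  (Y : measurableType dY) (mu : probability X R) (nu : probability Y R).

(** The ergodic theorem holds on the fibre over almost every y; Tonelli's theorem
    applied to W, the upper limit of the deviations from the mean, exchanges the
    order of the two almost-everywhere quantifiers. *)
Lemma birkhoff_fibrewise (f finv : X -> X) (phi : X * Y -> R) :
  invertible_measure_preserving mu f finv -> ergodic mu f ->
  (mu \x nu)%E.-integrable setT (EFin \o phi) ->
  {ae mu, forall x, {ae nu, forall y,
    n%:R^-1 * birkhoff_sum f (fun x => phi (x, y)) n x @[n --> \oo] -->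
      fine (\int[mu]_x (phi (x, y))%:E)}}.
Proof.
move=> f_pmp f_erg iphi.
have mphi : measurable_fun setT phi.
  by apply/measurable_EFinP; case/integrableP: iphi.
have [_ mf _ _] := f_pmp.
pose G y := fine (\int[mu]_x (phi (x, y))%:E)%E.
have mG : measurable_fun setT G.
  apply: measurableT_comp; first exact: fine_measurable.
  exact: measurable_fubini_G iphi.
pose u n (xy : X * Y) := n%:R^-1 * birkhoff_sum f (fun x => phi (x, xy.2)) n xy.1.
have miter i : measurable_fun setT (iter i f).
  elim: i => [|i IH]; first exact: measurable_id.
  by rewrite (_ : iter i.+1 f = f \o iter i f)//; exact: measurableT_comp.
have mu_ n : measurable_fun setT (u n).
  apply: measurable_funM; first exact: measurable_cst.
  apply: measurable_sum => i.
  apply: (@measurableT_comp _ _ _ _ _ _ phi _ (fun xy => (iter i f xy.1, xy.2))) => //.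
  apply: measurable_fun_pair; last exact: measurable_snd.
  by apply: (measurableT_comp (miter i)); exact: measurable_fst.
pose D n (xy : X * Y) := `|u n xy - G xy.2|%:E.
pose W xy := limn_esup (fun n => D n xy).
have mW : measurable_fun setT W.
  apply: measurable_fun_limn_esup => n; apply/measurable_EFinP.
  apply: measurableT_comp => //; apply: measurable_funB => //.
  by apply: (measurableT_comp mG); exact: measurable_snd.
have W0 xy : (0 <= W xy)%E by apply: limn_esup_ge0 => n; rewrite lee_fin.
have WG : (\int[nu]_y \int[mu]_x W (x, y) = 0)%E.
  rewrite -[RHS](@integral0 _ _ _ nu setT); apply: ae_eq_integral => //.
    exact: measurable_fun_fubini_tonelli_G.
  have := ae_integrable2 iphi; apply: filterS => y iy _.
  rewrite -[RHS](@integral0 _ _ _ mu setT); apply: ae_eq_integral => //.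
    exact: measurable_fun_pair1.
  have := birkhoff_ergodic f_pmp f_erg iy; apply: filterS => x cx _.
  rewrite /W (@cvg_limn_einf_sup _ _ 0%E _).2//.
  apply/fine_cvgP; split; first exact: nearW.
  rewrite /D /=; apply/cvgrPdist_le => e e0.
  move/cvgrPdist_le : cx => /(_ e e0); apply: filterS => n.
  by rewrite /= sub0r normrN normr_id distrC.
have WF : (\int[mu]_x \int[nu]_y W (x, y) = 0)%E by rewrite fubini_tonelli.
have mWF : measurable_fun setT (fun x => \int[nu]_y W (x, y))%E.
  exact: measurable_fun_fubini_tonelli_F.
have aeF : ae_eq mu setT (fun x => \int[nu]_y W (x, y))%E (cst 0%E).
  apply/(ae_eq_integral_abs mu measurableT mWF).
  rewrite -[RHS]WF; apply: eq_integral => x _.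
  by rewrite gee0_abs//; exact: integral_ge0.
apply: filterS aeF => x /(_ I) Wx.
have mWx : measurable_fun setT (fun y => W (x, y)) by exact: measurable_fun_pair2.
have aeW : ae_eq nu setT (fun y => W (x, y)) (cst 0%E).
  apply/(ae_eq_integral_abs nu measurableT mWx).
  by rewrite -[RHS]Wx; apply: eq_integral => y _; rewrite gee0_abs.
apply: filterS aeW => y /(_ I) Wxy.
have /fine_cvgP[_] : D n (x, y) @[n --> \oo] --> 0%E.
  apply: limn_esup_le_cvg; first by rewrite -/(W (x, y)) Wxy.
  by move=> n; rewrite lee_fin.
move=> /cvgrPdist_le h; apply/cvgrPdist_le => e e0.
apply: filterS (h e e0) => n.
by rewrite /= sub0r normrN normr_id distrC.
Qed.

(** By Fatou's lemma applied to |u_n - h|. *)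
Lemma Lnorm2_lim_unique (u : nat -> Y -> R) (g h : Y -> R) :
  (forall n, measurable_fun setT (u n)) -> measurable_fun setT h ->
  {ae nu, forall y, u n y @[n --> \oo] --> g y} ->
  ('N[nu]_2%:E [(fun y => (u n y - h y)%:E)])%E @[n --> \oo] --> 0%E ->
  {ae nu, forall y, g y = h y}.
Proof.
move=> mu_ mh ug uh.
have mN n : measurable_fun setT (fun y => `|u n y - h y|%:E).
  by apply/measurable_EFinP; apply: measurableT_comp => //; exact: measurable_funB.
have uh1 : (\int[nu]_y `|u n y - h y|%:E)%E @[n --> \oo] --> 0%E.
  apply: (squeeze_cvge _ _ uh); last exact: cvg_cst.
  apply: nearW => n; rewrite integral_ge0//=.
  by apply: L1_le_Lnorm2; exact: measurable_funB.
have := @fatou _ _ _ nu setT measurableT (fun n y => `|u n y - h y|%:E)%E mN.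
rewrite (@cvg_limn_einf_sup _ _ 0%E uh1).1 => /(_ (fun _ _ _ => normr_ge0 _)) F.
pose V y := limn_einf (fun n => `|u n y - h y|%:E)%E.
have mV : measurable_fun setT V.
  apply: measurableT_comp; first exact: oppe_measurable.
  apply: measurable_fun_limn_esup => n.
  by apply: measurableT_comp => //; exact: oppe_measurable.
have V0 y : (0 <= V y)%E by apply: limn_einf_ge0 => n; rewrite lee_fin.
have aeV : ae_eq nu setT V (cst 0%E).
  apply/(ae_eq_integral_abs nu measurableT mV).
  apply/eqP; rewrite eq_le integral_ge0// andbT.
  by under eq_integral => y _ do rewrite gee0_abs//.
apply: filterS2 aeV ug => y /(_ I) Vy uy.
have cV : `|u n y - h y|%:E @[n --> \oo] --> `|g y - h y|%:E.
  apply/fine_cvgP; split; first exact: nearW.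
  by apply: cvg_norm; apply: cvgB => //; exact: cvg_cst.
move: Vy; rewrite /V (@cvg_limn_einf_sup _ _ _ cV).1 => -[] /eqP.
by rewrite normr_eq0 subr_eq0 => /eqP.
Qed.

End Ergodic.

(** * The cocycle *)

Section Cocycle.
Context (R : realType) (dX dY : measure_display) (X : measurableType dX)
  (Y : measurableType dY) (mu : probability X R) (nu : probability Y R).

(** A strongly measurable family of essentially bounded functions has a jointly
    measurable modulus, up to a null set for each x. *)
Lemma sot_joint_modulus (c : X -> Y -> R[i]) : standard_borel R Y ->
  sot_measurable nu c -> (forall x, Linfty nu (c x)) ->
  exists2 H : X * Y -> R, measurable_fun setT H &
    forall x, {ae nu, forall y, H (x, y) = modulus (c x) y}.
Proof.
move=> stdY mc Lc; have [B YB] := standard_borel_countably_generated stdY.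
pose g k := if @unpickle (seq (rat * seq nat)) k is Some p
  then @rational_step R _ Y B p else fun=> 0.
have mg k : measurable_fun setT (g k).
  by rewrite /g; case: unpickle => // p; exact: measurable_rational_step.
apply: (@joint_version _ _ _ _ _ nu (fun x => modulus (c x)) g) => //.
- by move=> x; apply: measurable_modulus; case: (Lc x).
- move=> x e e0.
  have [_ /(_ e e0) [p hp]] := step_approx_integrable YB (Linfty_integrable (Lc x)).
  by exists (pickle p); rewrite /g pickleK.
- by move=> k r; exact: sot_measurable_L1_ball.
Qed.

Lemma cocycle_log_modulus (f finv : X -> X) (c : int -> X -> Y -> R[i])
    (phi : X * Y -> R) :
  (forall n x, {ae nu, forall y, c n x y != 0}) ->
  (forall n m : int, {ae mu, forall x, {ae nu, forall y,
     c (n + m) x y = c n (int_iter f finv m x) y * c m x y}}) ->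
  (forall x, {ae nu, forall y, phi (x, y) = log_modulus (c 1 x) y}) ->
  {ae mu, forall x, {ae nu, forall y, forall n : nat,
    log_modulus (c n%:Z x) y =
      log_modulus (c 0 x) y + birkhoff_sum f (fun x => phi (x, y)) n x}}.
Proof.
move=> c0 cc phic.
have : {ae mu, forall x, forall n : nat, {ae nu, forall y,
    c (1 + n%:Z) x y = c 1 (iter n f x) y * c n%:Z x y}}.
  by apply/ae_foralln => n; exact: (cc 1 n%:Z).
apply: filterS => x /ae_foralln cx.
have cn0 : {ae nu, forall y, forall n : nat, c n%:Z x y != 0}.
  by apply/ae_foralln => n; exact: c0.
have c10 : {ae nu, forall y, forall n : nat, c 1 (iter n f x) y != 0}.
  by apply/ae_foralln => n; exact: c0.
have phin : {ae nu, forall y, forall n : nat,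
    phi (iter n f x, y) = log_modulus (c 1 (iter n f x)) y}.
  by apply/ae_foralln => n; exact: phic.
apply: filterS2 (filterI cx phin) (filterI cn0 c10) => y [cxy phiy] [cny c1y].
elim=> [|n IH]; first by rewrite /birkhoff_sum big_ord0 addr0.
rewrite /birkhoff_sum big_ord_recr /= -/(birkhoff_sum f (fun x => phi (x, y)) n x).
rewrite addrA -IH phiy /log_modulus intS /modulus cxy ComplexField.Normc.normcM lnM.
- by rewrite addrC.
- rewrite posrE lt_neqAle (modulus_ge0 (c 1 (iter n f x))) eq_sym.
  by rewrite (modulus_eq0 (c 1 (iter n f x))) c1y.
- rewrite posrE lt_neqAle (modulus_ge0 (c n%:Z x)) eq_sym.
  by rewrite (modulus_eq0 (c n%:Z x)) cny.
Qed.

Lemma measurable_log_modulus (phi : Y -> R[i]) : cmeasurable phi ->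
  measurable_fun setT (log_modulus phi).
Proof.
move=> mphi; apply: measurableT_comp; first exact: measurable_ln.
exact: measurable_modulus.
Qed.

Lemma integrable_log_modulus (c : X -> Y -> R[i]) (phi : X * Y -> R) :
  measurable_fun setT phi -> (forall x, cmeasurable (c x)) ->
  (forall x, {ae nu, forall y, phi (x, y) = log_modulus (c x) y}) ->
  (\int[mu]_x 'N[nu]_2%:E [EFin \o log_modulus (c x)] < +oo)%E ->
  (mu \x nu)%E.-integrable setT (EFin \o phi).
Proof.
move=> mphi mc phic cfin.
have mE : measurable_fun setT (EFin \o phi) by exact/measurable_EFinP.
apply/integrable12ltyP => //; apply: le_lt_trans cfin.
have mlog x : measurable_fun setT (log_modulus (c x)) by exact: measurable_log_modulus.
have mphix x : measurable_fun setT (fun y => phi (x, y)) by exact: measurable_fun_pair2.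
have N2E x : ('N[nu]_2%:E [EFin \o log_modulus (c x)] =
    (\int[nu]_y (phi (x, y) ^+ 2)%:E) `^ 2^-1)%E.
  rewrite Lnorm2E; congr (_ `^ _)%E; apply: ae_eq_integral => //.
  - by apply/measurable_EFinP; exact: measurable_funX.
  - by apply/measurable_EFinP; exact: measurable_funX.
  - by apply: filterS (phic x) => y /= -> _.
apply: ge0_le_integral => //.
- by move=> x _; exact: integral_ge0.
- apply: (measurable_fun_fubini_tonelli_F (fun xy => `|(phi xy)%:E|%E)) => //.
  exact: measurableT_comp.
- under eq_fun do rewrite N2E.
  apply: (measurableT_comp (measurable_poweR _)).
  apply: (measurable_fun_fubini_tonelli_F (fun xy => (phi xy ^+ 2)%:E)).
    by apply/measurable_EFinP; exact: measurable_funX.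
  by move=> xy; rewrite lee_fin sqr_ge0.
move=> x _; apply: le_trans (L1_le_Lnorm2 nu (mlog x)).
rewrite le_eqVlt; apply/orP; left; apply/eqP; apply: ae_eq_integral => //.
- by apply/measurable_EFinP; exact: measurableT_comp.
- by apply/measurable_EFinP; exact: measurableT_comp.
- by apply: filterS (phic x) => y /= -> _.
Qed.

End Cocycle.

Unset Implicit Arguments.
Set Strict Implicit.
Set Printing Implicit Defensive.

Theorem proposition2p3 (R : realType)
  (dX : measure_display) (X : measurableType dX) (mu : probability X R)
  (dY : measure_display) (Y : measurableType dY) (nu : probability Y R)
  (stdX : standard_borel R X) (stdY : standard_borel R Y)
  (f finv : X -> X)
  (f_pmp : invertible_measure_preserving mu f finv)
  (f_ergodic : ergodic mu f)
  (c : int -> X -> Y -> R[i])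
  (c_range : forall n x, Linfty_units nu (c n x) /\ GL2 nu (c n x))
  (c_cocycle : forall n m : int, {ae mu, forall x, {ae nu, forall y,
     c (n + m) x y = c n (int_iter f finv m x) y * c m x y}})
  (c_measurable : forall n, sot_measurable nu (c n))
  (c_integrable :
     (\int[mu]_x 'N[nu]_2%:E [EFin \o log_modulus (c 1%R x)] < +oo)%E)
  (Lambda : X -> Y -> R)
  (Lambda_limit : {ae mu, forall x,
     log_limit nu (fun n : nat => c n%:Z x) (Lambda x)}) :
  {ae mu, forall x, exists H : set (Y -> R[i]),
     essentially_dense nu H /\
     forall xi, H xi -> exists l : \bar R,
       (fun n : nat =>
          (norm2 nu (fun y => c n%:Z x y * xi y)%R `^ n%:R^-1)%E) @ \oo --> l /\
       (fun n : nat =>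
          (norm2 nu (fun y => (Lambda x y ^+ n)%:C * xi y)%R `^ n%:R^-1)%E)
         @ \oo --> l}.
Proof.
have cL n x : Linfty nu (c n x) by case: (c_range n x) => -[].
have mc n x : cmeasurable (c n x) by case: (cL n x).
have c0 n x : {ae nu, forall y, c n x y != 0} by case: (c_range n x) => -[].
have [H mH Hc] := sot_joint_modulus stdY (c_measurable 1) (cL 1).
pose phi xy := ln (H xy).
have mphi : measurable_fun setT phi.
  by apply: measurableT_comp => //; exact: measurable_ln.
have phic x : {ae nu, forall y, phi (x, y) = log_modulus (c 1 x) y}.
  by apply: filterS (Hc x) => y Hy; rewrite /phi Hy.
have iphi := integrable_log_modulus mphi (mc 1) phic c_integrable.
have Bx := birkhoff_fibrewise f_pmp f_ergodic iphi.
have Cx := cocycle_log_modulus c0 c_cocycle phic.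
apply: filterS3 Lambda_limit Bx Cx => x [mL L0 _ L2lim] Bx Cx.
pose u n y := n%:R^-1 * log_modulus (c n%:Z x) y.
have mu_ n : measurable_fun setT (u n).
  apply: measurable_funM; first exact: measurable_cst.
  exact: measurable_log_modulus.
have mlnL : measurable_fun setT (fun y => ln (Lambda x y)).
  by apply: measurableT_comp => //; exact: measurable_ln.
have uG : {ae nu, forall y, u n y @[n --> \oo] -->
    fine (\int[mu]_x (phi (x, y))%:E)%E}.
  apply: filterS2 Bx Cx => y By Cy.
  rewrite (_ : (fun n => u n y) = (fun n : nat =>
      n%:R^-1 * log_modulus (c 0 x) y +
      n%:R^-1 * birkhoff_sum f (fun x => phi (x, y)) n x)); last first.
    by apply/funext => n; rewrite /u Cy mulrDr.
  have inv0 : (n%:R^-1 : R) @[n --> \oo] --> (0 : R).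
    apply/gtr0_cvgV0; last exact: cvgr_idn.
    by exists 1%N => // n /= n0; rewrite ltr0n.
  have := cvgD (cvgM inv0 (cvg_cst (log_modulus (c 0 x) y))) By.
  by rewrite mul0r add0r; apply.
have GL := Lnorm2_lim_unique mu_ mlnL uG L2lim.
have uL : {ae nu, forall y, u n y @[n --> \oo] --> ln (Lambda x y)}.
  by apply: filterS2 uG GL => y + <-.
exists (uniform_vectors nu u (fun y => ln (Lambda x y))); split.
  exact: uniform_vectors_dense.
move=> xi Hxi; exists (weighted_ess_sup nu (Lambda x) (modulus xi)).
exact: (uniform_vectors_limit (c := fun n => c n%:Z x)).
Qed.
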